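(* Let $m \geq 2$, let $D \subset \mathbb{R}^m$ be a domain, and let $u \in C^2(D)$ be harmonic in $D$ (i.e. $\nabla^2 u = 0$ in $D$). Then for every $x \in D$ and every $r > 0$ such that the closed ball $\overline{B_r(x)} = \{y : |y-x| \le r\}$ is contained in $D$, \[ u(x) = \frac{m}{|B_r|} \int_{B_r(x)} u(y) \log \frac{r}{|x-y|} \, \mathrm{d}y , \] where $B_r(x) = \{y : |y-x| < r\}$ and $|B_r|$ denotes its Lebesgue measure.
   Context: $|B_r| = \omega_m r^m / m$ with $\omega_m = 2\pi^{m/2}/\Gamma(m/2)$ the surface area of the unit sphere in $\mathbb{R}^m$. *)

(* Defs.v *)
From HB Require Import structures.
From mathcomp Require Import all_boot all_order all_algebra.
From mathcomp Require Import all_classical all_reals all_analysis.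
Set Implicit Arguments. Unset Strict Implicit. Unset Printing Implicit Defensive.
Import Order.TTheory GRing.Theory Num.Theory numFieldNormedType.Exports.
Local Open Scope classical_set_scope.
Local Open Scope ring_scope.

(* Euclidean norm on R^m (the library norm on 'rV is the max-norm, which
   induces the same topology but is not the Euclidean length). *)
Definition enorm (R : realType) (m : nat) (y : 'rV[R]_m) : R :=
  Num.sqrt (\sum_(i < m) (y 0 i) ^+ 2).

Definition evec (R : realType) (m : nat) (i : 'I_m) : 'rV[R]_m := delta_mx 0 i.

Definition partial (R : realType) (m : nat) (i : 'I_m) (u : 'rV[R]_m -> R)
  : 'rV[R]_m -> R := fun y => derive u y (evec R i).

Definition C2_on (R : realType) (m : nat) (D : set 'rV[R]_m) (u : 'rV[R]_m -> R) : Prop :=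
  (forall y, D y -> differentiable u y) /\
  (forall i y, D y -> differentiable (partial i u) y) /\
  (forall i j, {within D, continuous (partial j (partial i u))}).

Definition laplacian (R : realType) (m : nat) (u : 'rV[R]_m -> R) : 'rV[R]_m -> R :=
  fun y => \sum_(i < m) partial i (partial i u) y.

Definition harmonic_on (R : realType) (m : nat) (D : set 'rV[R]_m) (u : 'rV[R]_m -> R) : Prop :=
  forall y, D y -> laplacian u y = 0.

Definition domain (R : realType) (m : nat) (D : set 'rV[R]_m) : Prop :=
  D !=set0 /\ open D /\ connected D.

(* The Lebesgue integral over R^m, realised as the iterated one-dimensional
   Lebesgue integral over the coordinates (R^m has no Lebesgue measure in the
   library).  iint m f = \int dy_0 \int dy_1 ... \int dy_(m-1) f(y). *)
Fixpoint iint (R : realType) (m : nat) : ('rV[R]_m -> \bar R) -> \bar R :=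
  match m with
  | 0 => fun f => f 0
  | n.+1 => fun f =>
      (\int[@lebesgue_measure R]_(t in [set: R])
         iint (fun v : 'rV[R]_n => f (row_mx (const_mx t : 'rV[R]_1) v)))%E
  end.

Definition eball (R : realType) (m : nat) (x : 'rV[R]_m) (r : R) : set 'rV[R]_m :=
  [set y | enorm (y - x) < r].

Definition eclosed_ball (R : realType) (m : nat) (x : 'rV[R]_m) (r : R) : set 'rV[R]_m :=
  [set y | enorm (y - x) <= r].

Definition ball_vol (R : realType) (m : nat) (r : R) : \bar R :=
  iint (fun y : 'rV[R]_m => if `[< eball 0 r y >] then 1%E else 0%E).

(* Main.v *)
(** Write p(y) = max(0, 1 - |y - x|^2 / r^2). If f is C^1 on [0, +oo[ with
    f(0) = f'(0) = 0, then f(p) is C^1 on R^m with compact support and gradient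
    -2 f'(p) (y - x) / r^2. Integrals of partial derivatives of such functions
    vanish by translation invariance, which gives two identities.

    Applied to the fields f(p) grad u(x + s(y - x)), they show that the radial
    derivative of u(x + s(y - x)) integrates to 0 against f'(p), since u is
    harmonic; hence the integral of f'(p(y)) u(x + s(y - x)) does not depend on
    s, and comparing s = 1 with s = 0 yields a mean value property for the
    kernel f'(p), in particular for all powers p^k with k >= 1.

    Applied to f(p) (y - x), they give the recurrence
    (m + 2(k+1)) I_(k+1) = 2(k+1) I_k for the moments I_k of p over the ball,
    so that m (I_1/1 + ... + I_N/N) = 2 (I_0 - I_N), where I_0 = |B_r|.

    As ln(r / |y - x|) = -(1/2) ln(1 - p) is half of the sum of p^k / k over
    k >= 1, summing the mean value properties concludes. *)

Require Import Defs.
From HB Require Import structures.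
From mathcomp Require Import all_boot all_order all_algebra.
From mathcomp Require Import all_classical all_reals all_analysis.
From mathcomp Require Import measurable_realfun ring.
Import Order.TTheory GRing.Theory Num.Theory numFieldNormedType.Exports.
Local Open Scope classical_set_scope.
Local Open Scope ring_scope.
Set Implicit Arguments. Unset Strict Implicit. Unset Printing Implicit Defensive.

(** * Lebesgue measure on row vectors *)

Section borel.
Variables (R : realType) (n : nat).
Let coor (i : 'I_n) (y : 'rV[R]_n) : measurableTypeR R := y 0 i.

Let rV_set0 : g_sigma_preimage coor set0.
Proof. exact: sigma_algebra0. Qed.
Let rV_setC A : g_sigma_preimage coor A -> g_sigma_preimage coor (~` A).
Proof. exact: sigma_algebraC. Qed.
Let rV_bigcup (F : _^nat) : (forall i, g_sigma_preimage coor (F i)) ->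
  g_sigma_preimage coor (\bigcup_i (F i)).
Proof. exact: sigma_algebra_bigcup. Qed.

(** The sigma-algebra generated by the coordinates, that is, the product of the Borel sigma-algebras
    of the factors. *)
HB.instance Definition _ := @isMeasurable.Build default_measure_display
  'rV[R]_n (g_sigma_preimage coor) rV_set0 rV_setC rV_bigcup.
End borel.

(** Pulling back along [f] commutes with generating a sigma-algebra, so it is enough to test the
    generators, which are preimages under single coordinates. *)
Lemma measurable_funrVP (R : realType) n d (T : measurableType d) (f : T -> 'rV[R]_n) :
  measurable_fun [set: T] f <->
  forall i, measurable_fun [set: T] (fun t => f t 0 i).
Proof.
pose coor (i : 'I_n) (y : 'rV[R]_n) : measurableTypeR R := y 0 i.
apply: (@iff_trans _ (g_sigma_preimage (fun i => coor i \o f) `<=` measurable)).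
  rewrite g_sigma_preimage_comp; split=> [mf A [/= C preC <-]|prefS].
    exact: mf.
  by move=> _ A mA; apply: prefS; exists A.
split=> [tnthfS i|mf].
- move=> _ A mA.
  apply: tnthfS; apply: sub_sigma_algebra.
  rewrite -bigcup_seq/=; exists i => /=; first by rewrite mem_index_enum.
  by exists A.
- apply: smallest_sub; first exact: sigma_algebra_measurable.
  rewrite -bigcup_seq; apply: bigcup_sub => i Ii.
  by move=> A [B mB <-]; exact: mf.
Qed.

Lemma measurable_coord (R : realType) n (i : 'I_n) :
  measurable_fun [set: 'rV[R]_n] (fun y => y 0 i).
Proof. by move: i; apply/(@measurable_funrVP _ _ _ _ id). Qed.

(** The new coordinate comes first, exactly as in the recursion of [iint]; this makes the measure
    below match the iterated integral. *)
Definition rcons0 (R : realType) n (p : R * 'rV[R]_n) : 'rV[R]_n.+1 :=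
  row_mx (const_mx p.1 : 'rV[R]_1) p.2.

Lemma rcons00 (R : realType) n (p : R * 'rV[R]_n) : rcons0 p 0 ord0 = p.1.
Proof.
rewrite /rcons0 mxE; case: splitP => [j _|k /=]; first by rewrite mxE.
by case: k.
Qed.

Lemma rcons0S (R : realType) n (p : R * 'rV[R]_n) i :
  rcons0 p 0 (lift ord0 i) = p.2 0 i.
Proof.
rewrite /rcons0 mxE; case: splitP => [j|k] /=; first by case: j => -[].
by rewrite /bump/= add1n add1n => -[] ik; congr (_ _ _); apply/val_inj.
Qed.

Lemma measurable_rcons0 (R : realType) n :
  measurable_fun [set: measurableTypeR R * 'rV[R]_n] (@rcons0 R n).
Proof.
apply/measurable_funrVP => i; case: (unliftP ord0 i) => [j ->|->].
  rewrite (_ : (fun _ => _) = (fun y : 'rV[R]_n => y 0 j) \o snd); last first.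
    by apply/funext => p; rewrite rcons0S.
  by apply: measurableT_comp => //; exact: measurable_coord.
rewrite (_ : (fun _ => _) = fst)//.
by apply/funext => p; rewrite rcons00.
Qed.

Definition rsplit0 (R : realType) n (y : 'rV[R]_n.+1) : R * 'rV[R]_n :=
  (y 0 ord0, \row_i y 0 (lift ord0 i)).

Lemma rcons0K (R : realType) n : cancel (@rcons0 R n) (@rsplit0 R n).
Proof.
move=> [t v]; rewrite /rsplit0 rcons00; congr pair.
by apply/rowP => i; rewrite mxE rcons0S.
Qed.

Lemma rsplit0K (R : realType) n : cancel (@rsplit0 R n) (@rcons0 R n).
Proof.
move=> y; apply/rowP => i; case: (unliftP ord0 i) => [j ->|->].
  by rewrite rcons0S mxE.
by rewrite rcons00.
Qed.

Lemma measurable_rsplit0 (R : realType) n :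
  measurable_fun [set: 'rV[R]_n.+1]
    (@rsplit0 R n : _ -> measurableTypeR R * 'rV[R]_n).
Proof.
apply/measurable_fun_pairP; split; first exact: measurable_coord.
apply/measurable_funrVP => i.
rewrite (_ : (fun _ => _) = fun y : 'rV[R]_n.+1 => y 0 (lift ord0 i)).
  exact: measurable_coord.
by apply/funext => y /=; rewrite mxE.
Qed.

(** * Lebesgue measure by induction on the dimension *)

Section lebnS.
Variables (R : realType) (n : nat)
  (mu : {sigma_finite_measure set 'rV[R]_n -> \bar R}).

(** The product measure, transported along the measurable bijection [rcons0] from pairs to row
    vectors. *)
Definition lebnS : set 'rV[R]_n.+1 -> \bar R :=
  pushforward (@lebesgue_measure R \x mu)%E (@rcons0 R n).

Let nu : {measure set 'rV[R]_n.+1 -> \bar R} :=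
  measure_function_pushforward__canonical__measure_function_Measure
    (@lebesgue_measure R \x mu)%E (@measurable_rcons0 R n).

Let lebnS0 : lebnS set0 = 0%E. Proof. exact: (measure0 nu). Qed.
Let lebnS_ge0 A : (0 <= lebnS A)%E. Proof. exact: (measure_ge0 nu). Qed.
Let lebnS_sigma_additive : semi_sigma_additive lebnS.
Proof. exact: (@measure_semi_sigma_additive _ _ _ nu). Qed.
HB.instance Definition _ := isMeasure.Build _ _ _ lebnS
  lebnS0 lebnS_ge0 lebnS_sigma_additive.

Let lebnS_sigma_finite : sigma_finite setT lebnS.
Proof.
have /sigma_finiteP[F [TF ndF Foo]] := sigma_finiteT (@lebesgue_measure R).
have /sigma_finiteP[G [TG ndG Goo]] := sigma_finiteT mu.
(* Both exhaustions are increasing, so a pair whose components lie in [F i] and [G j] lies in the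
   product of index [maxn i j]. *)
exists (fun k => @rsplit0 R n @^-1` (F k `*` G k)).
  apply/seteqP; split => // y _.
  have : setT (rsplit0 y).1 by []. rewrite TF => -[i _ Fi].
  have : setT (rsplit0 y).2 by []. rewrite TG => -[j _ Gj].
  exists (maxn i j) => //; split.
    by have /subsetPset := ndF _ _ (leq_maxl i j); exact.
  by have /subsetPset := ndG _ _ (leq_maxr i j); exact.
move=> k; have [mF Fk] := Foo k; have [mG Gk] := Goo k; split.
  rewrite -[X in measurable X]setTI; apply: measurable_rsplit0 => //.
  exact: measurableX.
rewrite /lebnS /pushforward -comp_preimage (_ : _ \o _ = id); last first.
  by apply/funext => p /=; rewrite rcons0K.
rewrite preimage_id product_measure1E//.
by rewrite lte_mul_pinfty// ge0_fin_numE.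
Qed.

HB.instance Definition _ := Measure_isSigmaFinite.Build _ _ _ lebnS
  lebnS_sigma_finite.

End lebnS.

(** In dimension 0 the mass is carried by the only point, in agreement with [iint f = f 0]. *)
Fixpoint lebn (R : realType) n : {sigma_finite_measure set 'rV[R]_n -> \bar R} :=
  match n with
  | 0 => dirac (0 : 'rV[R]_0)
  | k.+1 => lebnS (lebn R k)
  end.

(** * Fubini's theorem and the iterated integral *)

Section lebn_integral.
Local Open Scope ereal_scope.
Variable R : realType.

Lemma ge0_integral_lebnS n (f : 'rV[R]_n.+1 -> \bar R) :
  measurable_fun setT f -> (forall y, 0 <= f y) ->
  \int[lebn R n.+1]_y f y =
  \int[@lebesgue_measure R]_t \int[lebn R n]_v f (rcons0 (t, v)).
Proof.
move=> mf f0.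
rewrite [LHS](@ge0_integral_pushforward _ _ _ _ _ _ (@measurable_rcons0 R n)
  (@lebesgue_measure R \x lebn R n) setT)//.
rewrite preimage_setT fubini_tonelli1//=.
by apply: measurableT_comp => //; exact: measurable_rcons0.
Qed.

Lemma integrable_rcons0 n (f : 'rV[R]_n.+1 -> \bar R) :
  (lebn R n.+1).-integrable setT f ->
  (@lebesgue_measure R \x lebn R n).-integrable setT (f \o @rcons0 R n).
Proof.
move=> intf; have mf := measurable_int _ intf; apply/integrableP; split.
  by apply: measurableT_comp => //; exact: measurable_rcons0.
case/integrableP: intf => _; apply: le_lt_trans.
rewrite [leRHS](@ge0_integral_pushforward _ _ _ _ _ _ (@measurable_rcons0 R n)
  (@lebesgue_measure R \x lebn R n) setT)//.
exact: measurableT_comp.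
Qed.

Lemma integral_lebnS n (f : 'rV[R]_n.+1 -> \bar R) :
  (lebn R n.+1).-integrable setT f ->
  \int[lebn R n.+1]_y f y =
  \int[@lebesgue_measure R]_t \int[lebn R n]_v f (rcons0 (t, v)).
Proof.
move=> intf; have mf := measurable_int _ intf.
have intf' := integrable_rcons0 intf.
rewrite [LHS](@integral_pushforward _ _ _ _ _ _ (@measurable_rcons0 R n)
  (@lebesgue_measure R \x lebn R n) setT)//.
by rewrite preimage_setT -integral12_prod_meas1.
Qed.

(** The parameter space [T] is arbitrary because the induction moves one coordinate of the vector
    into it. The outer integral is then the difference of the integrals of the positive and negative
    parts, each measurable by Tonelli. *)
Lemma measurable_iint n d (T : measurableType d) (F : T * 'rV[R]_n -> \bar R) :
  measurable_fun setT F -> measurable_fun setT (fun t => iint (fun v => F (t, v))).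
Proof.
elim: n d T F => [|n IH] d T F mF /=.
  by apply: measurableT_comp mF _; exact: measurable_pair2.
pose G (p : T * measurableTypeR R) :=
  iint (fun v : 'rV[R]_n => F (p.1, rcons0 (p.2, v))).
have mG : measurable_fun setT G.
  apply: (IH _ _ (fun q : (T * measurableTypeR R) * 'rV[R]_n =>
     F (q.1.1, rcons0 (q.1.2, q.2)))).
  apply: measurableT_comp mF _; apply/measurable_fun_pairP; split => /=.
    exact: (measurableT_comp measurable_fst measurable_fst).
  apply: (measurableT_comp (@measurable_rcons0 R n)).
  apply/measurable_fun_pairP; split => //=.
    exact: (measurableT_comp measurable_snd measurable_fst).
  exact: measurable_snd.
pose Gp t := \int[@lebesgue_measure R]_s (G^\+ (t, s)).
pose Gm t := \int[@lebesgue_measure R]_s (G^\- (t, s)).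
apply: (@eq_measurable_fun _ _ T (\bar R) setT (Gp \- Gm)).
  move=> t _.
  have E := integralE (@lebesgue_measure R) setT (fun s => G (t, s)).
  apply/esym; rewrite [LHS]E; congr (_ - _); apply: eq_integral => s _.
    by rewrite !funeposE.
  by rewrite !funenegE.
apply: emeasurable_funB.
  apply: (@measurable_fun_fubini_tonelli_F _ _ _ _ _ (@lebesgue_measure R) (G^\+)) => //.
  exact: measurable_funepos.
apply: (@measurable_fun_fubini_tonelli_F _ _ _ _ _ (@lebesgue_measure R) (G^\-)) => //.
exact: measurable_funeneg.
Qed.

(** Fubini, one coordinate at a time. A slice of an integrable function is integrable for almost
    every [t] only, so the induction hypothesis gives an equality almost everywhere;
    [measurable_iint] then makes the two outer integrals comparable. *)
Lemma iint_integral n (f : 'rV[R]_n -> \bar R) :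
  (lebn R n).-integrable setT f -> iint f = \int[lebn R n]_y f y.
Proof.
elim: n f => [|n IH] f intf /=.
  rewrite integral_dirac//; last exact: measurable_int intf.
  by rewrite diracT mul1e.
have mf := measurable_int _ intf.
have intf' := integrable_rcons0 intf.
rewrite integral_lebnS//; apply: ae_eq_integral => //.
- apply: (@measurable_iint n _ (measurableTypeR R) (f \o @rcons0 R n)).
  by apply: measurableT_comp => //; exact: measurable_rcons0.
- exact: (measurable_fubini_F intf').
- apply: filterS (ae_integrable1 intf') => t intt _.
  exact: IH.
Qed.

End lebn_integral.

(** * Translation invariance *)

Lemma measurable_shiftrV (R : realType) n (c : 'rV[R]_n) :
  measurable_fun [set: 'rV[R]_n] (fun y => y + c).
Proof.
apply/measurable_funrVP => i.
rewrite (_ : (fun _ => _) = (fun y : 'rV[R]_n => y 0 i + c 0 i)).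
  by apply: measurable_funD => //; exact: measurable_coord.
by apply/funext => y; rewrite mxE.
Qed.

Section translation.
Local Open Scope ereal_scope.
Variable R : realType.

Let measurable_shift (c : R) :
  measurable_fun [set: measurableTypeR R]
    (fun t : measurableTypeR R => (t + c)%R : measurableTypeR R).
Proof. exact: measurable_funD. Qed.

(** The image of Lebesgue measure under the shift gives half-open intervals their length, hence is
    Lebesgue measure by uniqueness. *)
Lemma ge0_integral_lebesgue_shift (c : R) (f : R -> \bar R) :
  measurable_fun [set: measurableTypeR R] f -> (forall t, 0 <= f t) ->
  \int[@lebesgue_measure R]_t f (t + c)%R = \int[@lebesgue_measure R]_t f t.
Proof.
move=> mf f0.
pose nu := measure_function_pushforward__canonical__measure_function_Measure
  (@lebesgue_measure R) (measurable_shift c).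
rewrite -[LHS](@ge0_integral_pushforward _ _ _ _ _ _ (measurable_shift c)
  (@lebesgue_measure R) setT)//.
apply: eq_measure_integral => A mA _; apply/esym.
apply: (@lebesgue_measure_unique R nu) => // _ [[a b] _ <-].
rewrite /nu/= /pushforward.
rewrite (_ : _ @^-1` _ = `](a - c)%R, (b - c)%R]%classic); last first.
  by apply/seteqP; split => t /=; rewrite !in_itv/= ltrBlDr lerBrDr.
rewrite !lebesgue_measure_itv/= !lte_fin ltrD2r.
by case: ifP => // _; rewrite -!EFinB; congr (_%:E); ring.
Qed.

(** By Tonelli the shift splits into one of the first coordinate and one of the remaining vector,
    which the induction hypothesis absorbs. *)
Lemma ge0_integral_lebn_shift n (c : 'rV[R]_n) (f : 'rV[R]_n -> \bar R) :
  measurable_fun setT f -> (forall y, 0 <= f y) ->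
  \int[lebn R n]_y f (y + c)%R = \int[lebn R n]_y f y.
Proof.
elim: n c f => [|n IH] c f mf f0.
  apply: eq_integral => y _; congr f; apply/rowP => -[]//.
have mfr : measurable_fun [set: measurableTypeR R * 'rV[R]_n]
    (fun p => f (rcons0 p)).
  by apply: measurableT_comp => //; exact: measurable_rcons0.
rewrite ge0_integral_lebnS//; last exact: (measurableT_comp mf (measurable_shiftrV c)).
rewrite ge0_integral_lebnS//.
have cE t v : (rcons0 (t, v) + c = rcons0 (t + (rsplit0 c).1, v + (rsplit0 c).2))%R.
  rewrite -{1}[c]rsplit0K; apply/rowP => i; rewrite mxE.
  case: (unliftP ord0 i) => [j ->|->]; last by rewrite !rcons00.
  by rewrite !rcons0S [in RHS]mxE.
rewrite -(@ge0_integral_lebesgue_shift (rsplit0 c).1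
  (fun t => \int[lebn R n]_v f (rcons0 (t, v)))).
- apply: eq_integral => t _.
  under eq_integral do rewrite cE.
  apply: (IH _ (fun v => f (rcons0 ((t + (rsplit0 c).1)%R, v)))) => //.
  apply: (measurableT_comp mfr); exact: measurable_pair1.
- exact: (@measurable_fun_fubini_tonelli_F _ _ _ _ R (lebn R n)
    (fun p => f (rcons0 p))).
- by move=> t; exact: integral_ge0.
Qed.

Lemma integral_lebn_shift n (c : 'rV[R]_n) (f : 'rV[R]_n -> \bar R) :
  measurable_fun setT f ->
  \int[lebn R n]_y f (y + c)%R = \int[lebn R n]_y f y.
Proof.
move=> mf; rewrite [LHS]integralE [RHS]integralE.
congr (_ - _).
  rewrite -[RHS](@ge0_integral_lebn_shift _ c)//; last exact: measurable_funepos.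
  by apply: eq_integral => y _; rewrite !funeposE.
rewrite -[RHS](@ge0_integral_lebn_shift _ c)//; last exact: measurable_funeneg.
by apply: eq_integral => y _; rewrite !funenegE.
Qed.

End translation.

(** * Points, cubes, continuous functions and Euclidean balls *)

Lemma measurable_rV_set1 (R : realType) n (x : 'rV[R]_n) : measurable [set x].
Proof.
rewrite (_ : [set x] = \bigcap_(i in [set: 'I_n]) [set y | y 0 i = x 0 i]).
  apply: fin_bigcap_measurable => // i _.
  rewrite -[X in measurable X]setTI.
  exact: (@measurable_coord R n i _ [set x 0 i]).
apply/seteqP; split => [y -> //|y yx].
by apply/rowP => i; exact: yx.
Qed.

(** The dimension has to be positive, since [lebn R 0] is a Dirac mass. It serves to discard the
    centre of the ball, where the logarithm is singular. *)
Lemma lebn_set1 (R : realType) n (x : 'rV[R]_n.+1) : lebn R n.+1 [set x] = 0%E.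
Proof.
rewrite /= /lebnS /pushforward.
rewrite (_ : _ @^-1` _ = [set (rsplit0 x).1] `*` [set (rsplit0 x).2]); last first.
  apply/seteqP; split => -[t v].
    by move=> xE; rewrite -[x]xE rcons0K.
  move=> [tE vE]; rewrite /preimage/= -[RHS]rsplit0K.
  by congr rcons0; rewrite [RHS]surjective_pairing; congr pair.
rewrite product_measure1E; [|exact: measurable_set1|exact: measurable_rV_set1].
by rewrite [X in (X * _)%E](lebesgue_measure_set1 (rsplit0 x).1) mul0e.
Qed.

(** Open cubes have an explicit volume; comparing balls with them shows that the volume of a ball is
    finite and positive. *)
Definition box (R : realType) n (a : R) : set 'rV[R]_n :=
  [set y | forall i, `|y 0 i| < a].

Arguments box {R} n a.

Lemma measurable_box (R : realType) n (a : R) : measurable (box n a).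
Proof.
rewrite (_ : box n a = \bigcap_(i in [set: 'I_n]) [set y | `|y 0 i| < a]).
  apply: fin_bigcap_measurable => // i _.
  suff : measurable [set y : 'rV[R]_n | `|y 0 i| < a] by [].
  rewrite (_ : [set y : 'rV[R]_n | `|y 0 i| < a] =
    setT `&` (fun y : 'rV[R]_n => y 0 i) @^-1` `]-a, a[).
    exact: (@measurable_coord R n i).
  by apply/seteqP; split => y /=; rewrite in_itv/= ltr_norml// => -[].
by apply/seteqP; split => y yx i; [move=> _; exact: yx|exact: (yx i)].
Qed.

Lemma lebn_box (R : realType) n (a : R) : 0 < a ->
  lebn R n (box n a) = ((a *+ 2) ^+ n)%:E.
Proof.
move=> a0; elim: n => [|n IH].
  rewrite /= /dirac indicE mem_set//=; case => //.
rewrite /= /lebnS /pushforward.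
rewrite (_ : _ @^-1` _ = `]-a, a[%classic `*` box n a); last first.
  apply/seteqP; split => -[t v] /=.
    move=> tv; split => [|i]; last by have := tv (lift ord0 i); rewrite rcons0S.
    by have := tv ord0; rewrite rcons00 in_itv/= ltr_norml.
  move=> [+ vn] i; rewrite in_itv/= -ltr_norml => ta.
  case: (unliftP ord0 i) => [j ->|->]; last by rewrite rcons00.
  by rewrite rcons0S; exact: vn.
rewrite product_measure1E//; last exact: measurable_box.
rewrite IH [X in (X * _)%E](lebesgue_measure_itv `]-a, a[)/= lte_fin gt0_cp//.
by rewrite -EFinB -EFinM; congr (_%:E); rewrite opprK exprS mulr2n.
Qed.

(* Approximation by functions that are constant on the cells of a cubic grid. *)
Lemma measurable_fun_continuous_on (R : realType) n (A : set 'rV[R]_n)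
    (f : 'rV[R]_n -> R) : measurable A ->
  (forall y, A y -> {for y, continuous f}) -> measurable_fun A f.
Proof.
move=> mA cf.
pose q k (y : 'rV[R]_n) : 'rV[R]_n :=
  \row_i ((Num.floor (k.+1%:R * y 0 i))%:~R / k.+1%:R).
apply: (@measurable_fun_cvg _ _ _ _ (fun k y => f (q k y))).
  move=> k; apply: measurable_funTS => _ B mB; rewrite setTI.
  pose z2v (z : {ffun 'I_n -> int}) : 'rV[R]_n := \row_i ((z i)%:~R / k.+1%:R).
  (* [f (q k y)] depends only on the cell of [y], and cells are indexed by the countable type
     [{ffun 'I_n -> int}]: the preimage is the union of the cells whose value lies in [B]. *)
  rewrite (_ : _ @^-1` _ = \bigcup_(z : {ffun 'I_n -> int})
      ((\bigcap_(i in [set: 'I_n])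
         [set y : 'rV[R]_n | Num.floor (k.+1%:R * y 0 i) = z i])
       `&` [set _ | B (f (z2v z))])).
    apply: countable_bigcupT_measurable; first exact: countableP.
    move=> z; apply: measurableI; last first.
      have [Bz|Bz] := pselect (B (f (z2v z))).
        by rewrite (_ : [set _ | _] = setT)//; apply/seteqP; split.
      by rewrite (_ : [set _ | _] = set0)//; apply/seteqP; split.
    apply: fin_bigcap_measurable => // i _.
    suff : measurable [set y : 'rV[R]_n | Num.floor (k.+1%:R * y 0 i) = z i] by [].
    rewrite (_ : [set y : 'rV[R]_n | Num.floor (k.+1%:R * y 0 i) = z i] =
       setT `&` (fun y : 'rV[R]_n => k.+1%:R * y 0 i) @^-1`
       `[(z i)%:~R, (z i + 1)%:~R[).
      exact: (measurable_funM (measurable_cst _) (@measurable_coord R n i)).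
    apply/seteqP; split => y /=; rewrite in_itv/=.
      by move=> <-; split=> //; exact: floor_itv.
    by move=> [_]; exact: floor_def.
  apply/seteqP; split => [y By|y [z _ [zy Bz]]].
    exists [ffun i => Num.floor (k.+1%:R * y 0 i)] => //; split.
      by move=> i _ /=; rewrite ffunE.
    rewrite /= (_ : z2v _ = q k y)//.
    by apply/rowP => i; rewrite !mxE ffunE.
  rewrite /= (_ : q k y = z2v z)//; apply/rowP => i; rewrite !mxE.
  by rewrite (zy i).
(* The corner [q k y] is within [1 / k.+1] of [y] in each coordinate. It may lie outside [A], but
   [f] is continuous at [y] in the whole space. *)
move=> y Ay; apply: (@cvg_comp _ _ _ (fun k => q k y) f _ (nbhs y) _ _ (cf y Ay)).
apply/(@cvg_ballP R 'rV[R]_n) => e e0; near=> k; split => // i j.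
rewrite /ball/= mxE !ord1.
have k0 : (0 : R) < k.+1%:R by rewrite ltr0n.
have ke : k.+1%:R^-1 < e by near: k; exact: near_infty_natSinv_lt (PosNum e0).
apply: le_lt_trans ke.
have /andP[f1 f2] := floor_itv (k.+1%:R * y 0 j).
rewrite ger0_norm; last by rewrite subr_ge0 ler_pdivrMr// [leRHS]mulrC.
rewrite lerBlDr -{1}[k.+1%:R^-1]mul1r -mulrDl ler_pdivlMr//.
by rewrite [leLHS]mulrC (le_trans (ltW f2))// intrD addrC.
Unshelve. all: by end_near.
Qed.

Lemma eball0_sub_box (R : realType) n (r : R) : eball 0 r `<=` box n r.
Proof.
move=> y; rewrite /eball/= subr0 => yr i; apply: le_lt_trans yr.
rewrite -sqrtr_sqr /enorm ler_wsqrtr//.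
rewrite (bigD1 i)//= lerDl; apply: sumr_ge0 => j _; exact: sqr_ge0.
Qed.

(** The squared norm is at most [n r^2 / (n + 1)^2]; dividing by [n + 1] keeps the bound strict and
    also makes sense for [n = 0]. *)
Lemma box_sub_eball0 (R : realType) n (r : R) : 0 < r ->
  box n (r / n.+1%:R) `<=` eball 0 r.
Proof.
move=> r0 y yb; rewrite /eball/= subr0 /enorm.
have n0 : (0 : R) < n.+1%:R by rewrite ltr0n.
rewrite -[ltRHS](@ger0_norm _ r) ?ltW// -sqrtr_sqr ltr_sqrt ?exprn_gt0//.
apply: (@le_lt_trans _ _ (\sum_(i < n) (r / n.+1%:R) ^+ 2)).
  apply: ler_sum => i _; rewrite -[leLHS]real_normK ?num_real//.
  by rewrite lerXn2r// ?nnegrE ?divr_ge0 ?ltW// yb.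
rewrite sumr_const card_ord -[ltLHS]mulr_natr.
rewrite expr_div_n -mulrA -[ltRHS]mulr1 ltr_pM2l ?exprn_gt0//.
rewrite mulrC ltr_pdivrMr ?exprn_gt0// mul1r -natrX ltr_nat.
by rewrite (@leq_trans n.+1)// leq_pmulr.
Qed.

Lemma measurable_enorm (R : realType) n (x : 'rV[R]_n) :
  measurable_fun setT (fun y : 'rV[R]_n => enorm (y - x)).
Proof.
apply: (measurableT_comp (continuous_measurable_fun (@sqrt_continuous R))).
apply: measurable_sum => i; apply: measurable_funX.
rewrite (_ : (fun _ => _) = (fun y : 'rV[R]_n => y 0 i - x 0 i)).
  by apply: measurable_funB => //; exact: measurable_coord.
by apply/funext => y; rewrite !mxE.
Qed.

Lemma measurable_eball (R : realType) n (x : 'rV[R]_n) (r : R) :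
  measurable (eball x r).
Proof.
rewrite (_ : eball x r = setT `&` (fun y => enorm (y - x)) @^-1` `]-oo, r[).
  exact: measurable_enorm.
by apply/seteqP; split => y /=; rewrite in_itv/=; [|case].
Qed.

Lemma lebn_eball_shift (R : realType) n (x : 'rV[R]_n) (r : R) :
  lebn R n (eball x r) = lebn R n (eball 0 r).
Proof.
have E z : lebn R n (eball z r) =
    (\int[lebn R n]_y (\1_(eball z r) y)%:E)%E.
  by rewrite integral_indic//= ?setIT//; exact: measurable_eball.
rewrite !E -(@ge0_integral_lebn_shift _ _ x).
- apply: eq_integral => y _; congr (_%:E); rewrite !indicE.
  congr (nat_of_bool _)%:R; apply/idP/idP => /set_mem H; apply/mem_set; move: H;
    by rewrite /eball/= addrK subr0.
- by apply/measurable_EFinP; apply: measurable_indic; exact: measurable_eball.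
- by move=> y; rewrite lee_fin indicE.
Qed.

Lemma lebn_eball_lty (R : realType) n (x : 'rV[R]_n) (r : R) : 0 < r ->
  (lebn R n (eball x r) < +oo)%E.
Proof.
move=> r0; rewrite lebn_eball_shift.
apply: (@le_lt_trans _ _ (lebn R n (box n r))); last by rewrite lebn_box// ltry.
apply: le_measure; rewrite ?inE; [exact: measurable_eball|exact: measurable_box|].
exact: eball0_sub_box.
Qed.

Lemma lebn_eball_gt0 (R : realType) n (x : 'rV[R]_n) (r : R) : 0 < r ->
  (0 < lebn R n (eball x r))%E.
Proof.
move=> r0; rewrite lebn_eball_shift.
have a0 : 0 < r / n.+1%:R by rewrite divr_gt0// ltr0n.
apply: (@lt_le_trans _ _ (lebn R n (box n (r / n.+1%:R)))).
  by rewrite lebn_box// lte_fin exprn_gt0// mulrn_wgt0.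
apply: le_measure; rewrite ?inE; [exact: measurable_box|exact: measurable_eball|].
exact: box_sub_eball0.
Qed.

(** * Integrals of partial derivatives *)

Section calculus.
Variable R : realType.
Implicit Types f g h phi : R -> R.

Lemma is_derive_cvgP f (a d : R) :
  is_derive a 1 f d <-> (t^-1 * (f (a + t) - f a) @[t --> 0^'] --> d).
Proof.
have E : (fun t => t^-1 * (f (a + t) - f a)) =
         (fun t => t^-1 *: (f (t *: 1 + a) - f a)).
  by apply/funext => t; rewrite [_ *: 1]mulr1 (addrC a).
rewrite E; split => [[df <-]//|cf].
by apply: DeriveDef; [exact: cvgP cf|exact: cvg_lim cf].
Qed.

Lemma is_derive_from0 f (a d : R) :
  is_derive (0 : R) 1 (fun t => f (a + t)) d -> is_derive a 1 f d.
Proof.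
move=> /is_derive_cvgP cf; apply/is_derive_cvgP; apply: cvg_trans cf.
by apply: near_eq_cvg; near=> t; rewrite add0r addr0.
Unshelve. all: by end_near.
Qed.

(** Squeezes the difference quotient of [h]. It handles points where a kernel vanishes to first
    order while its cofactor need not be differentiable. *)
Lemma is_derive0_dominated phi h (C : R) : phi 0 = 0 ->
  is_derive (0 : R) 1 phi 0 -> (forall t, `|h t| <= C * `|phi t|) ->
  is_derive (0 : R) 1 h 0.
Proof.
move=> phi0 /is_derive_cvgP cphi hC; apply/is_derive_cvgP.
have h0 : h 0 = 0.
  by apply/eqP; rewrite -normr_le0 (le_trans (hC 0))// phi0 normr0 mulr0.
apply/norm_cvg0P.
have cphi' : C * `|t^-1 * (phi (0 + t) - phi 0)| @[t --> 0^'] --> 0.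
  by have := cvgM (cvg_cst C) (cvg_norm cphi); rewrite normr0 mulr0; exact.
apply: (squeeze_cvgr _ (cvg_cst 0) cphi').
  near=> t; rewrite normr_ge0/=.
  rewrite !add0r h0 phi0 !subr0 !normrM mulrCA.
  by apply: ler_wpM2l => //; exact: hC.
Unshelve. all: by end_near.
Qed.

(** The truncation replaces [f] by the constant [f 0] on the negative half-line. At 0 the truncated
    increment is dominated by that of [f], whose derivative there is [df 0 = 0]. *)
Lemma is_derive_comp_max0 f (df : R -> R) :
  (forall t : R, 0 <= t -> is_derive t 1 f (df t)) -> df 0 = 0 ->
  forall t : R, is_derive t 1 (fun s => f (Num.max s 0)) (df (Num.max t 0)).
Proof.
move=> fdf df0 t; have [t0|t0|->] := ltgtP t 0.
- rewrite df0.
  apply: (@near_eq_is_derive _ _ _ (cst (f 0))).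
    by near=> s; rewrite max_r// ltW//; near: s; exact: lt_nbhsl.
- apply: (@near_eq_is_derive _ _ _ f).
    by near=> s; rewrite max_l// ltW//; near: s; exact: lt_nbhsr.
  exact: (fdf _ (ltW t0)).
rewrite df0.
have H : is_derive (0 : R) 1 (fun s => f (Num.max s 0) - f 0) 0.
  apply: (@is_derive0_dominated (fun s => f s - f 0) _ 1) => [||s].
  - by rewrite subrr.
  - rewrite -[X in is_derive _ _ _ X](subr0 0) -{3}df0.
    apply: is_deriveB; exact: fdf.
  - rewrite mul1r; case: (leP s 0) => s0; last by [].
    by rewrite subrr normr0.
rewrite -[X in is_derive _ _ _ X](addr0 0).
rewrite (_ : (fun s => _) = (fun s => f (Num.max s 0) - f 0) + cst (f 0)).
  exact: is_deriveD.
by apply/funext => s; rewrite fctE subrK.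
Unshelve. all: by end_near.
Qed.

End calculus.

Section divergence.
Variables (R : realType) (n : nat).
Implicit Types (x y : 'rV[R]_n) (h dh : 'rV[R]_n -> R).

(** By translation invariance the integral of [h (y + t *: evec R i)] does not depend on [t];
    differentiating under the integral sign at [t = 0] gives the integral of [dh]. *)
Lemma integral_partial_eq0 x (r C : R) (i : 'I_n) h dh : 0 < r ->
  measurable_fun setT h -> (lebn R n).-integrable setT (EFin \o h) ->
  measurable_fun setT dh ->
  (forall y, is_derive (0 : R) 1 (fun t => h (y + t *: evec R i)) (dh y)) ->
  (forall y, `|dh y| <= C) -> (forall y, ~ eball x r y -> dh y = 0) ->
  \int[lebn R n]_y dh y = 0.
Proof.
move=> r0 mh ih mdh hdh dhC dh0.
pose f (t : R) y := h (y + t *: evec R i).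
have fdh (t : R) y : is_derive t 1 (f ^~ y) (dh (y + t *: evec R i)).
  apply: is_derive_from0; rewrite /f.
  rewrite (_ : (fun s => _) = (fun s => h (y + t *: evec R i + s *: evec R i))).
    exact: hdh.
  by apply/funext => s; rewrite scalerDl addrA.
have mf t : measurable_fun setT (f t).
  by apply: measurableT_comp mh _; exact: measurable_shiftrV.
have I0 : `]-1, 1[%classic (0 : R) by rewrite /= in_itv/= ltrN10 ltr01.
(* The dominating function has to serve all shifts with [|t| < 1]. If such a shift of [y] lies in
   the ball, each coordinate of [y] is below [|x|_1 + r + 1], whence the size of the cube. *)
pose G y : R := C * \1_(box n (\sum_j `|x 0 j| + r + 1)) y.
have C0 : 0 <= C by exact: le_trans (dhC 0).
have intf t : (lebn R n).-integrable setT (EFin \o f t).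
  apply/integrableP; split; first exact/measurable_EFinP.
  case/integrableP : ih => _; apply: le_lt_trans; rewrite le_eqVlt; apply/orP; left.
  apply/eqP; rewrite -[RHS](@integral_lebn_shift _ _ (t *: evec R i))//.
  by apply: measurableT_comp => //; exact/measurable_EFinP.
have intG : (lebn R n).-integrable setT (EFin \o G).
  have iI : (lebn R n).-integrable setT
      (EFin \o (\1_(box n (\sum_j `|x 0 j| + r + 1)) : _ -> R)).
    have mb := @measurable_box R n (\sum_j `|x 0 j| + r + 1).
    apply/integrableP; split.
      by apply/measurable_EFinP; exact: measurable_indic.
    under eq_integral do rewrite gee0_abs ?lee_fin//.
    rewrite integral_indic// setIT.
    have b0 : 0 < \sum_j `|x 0 j| + r + 1 by rewrite addr_gt0// ltr_wpDl// sumr_ge0.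
    by rewrite [ltLHS](lebn_box n b0) ltry.
  by have := integrableZl measurableT C iI; apply: eq_integrable.
have d1f t y : partial1of2 f t y = dh (y + t *: evec R i).
  by rewrite partial1of2E; have [] := fdh t y.
have G0 y : 0 <= G y by rewrite mulr_ge0// indicE.
have Gub t y : `]-1, 1[%classic t -> setT y -> `|partial1of2 f t y| <= G y.
  rewrite /= in_itv/= => /andP[tN1 t1] _; rewrite d1f /G indicE.
  have [yb|yb] := pselect (eball x r (y + t *: evec R i)); last first.
    by rewrite dh0// normr0 mulr_ge0.
  rewrite mem_set ?mulr1// => j.
  have : box n r (y + t *: evec R i - x).
    by apply: eball0_sub_box; rewrite /eball/= subr0.
  move=> /(_ j); rewrite !mxE => yxr.
  have xj : `|x 0 j| <= \sum_j `|x 0 j|.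
    by rewrite (bigD1 j)//= lerDl sumr_ge0.
  have tj : `|t * ((0 == 0 :> 'I_1) && (j == i))%:R| <= 1.
    rewrite eqxx/= normrM; case: eqP => _; last by rewrite normr0 mulr0.
    by rewrite normr1 mulr1 ltW// ltr_norml tN1.
  rewrite (_ : y 0 j = (y 0 j + t * ((0 == 0 :> 'I_1) && (j == i))%:R - x 0 j) +
     x 0 j - t * ((0 == 0 :> 'I_1) && (j == i))%:R); last by ring.
  rewrite (le_lt_trans (ler_normB _ _))// (le_lt_trans (lerD (ler_normD _ _) tj))//.
  by rewrite ltrD2r addrC ler_ltD.
have cvgF := @cvg_differentiation_under_integral R _ _ (lebn R n) f setT measurableT
  0 (-1) 1 I0 (fun t _ => intf t)
  (fun t y _ _ => let: conj H _ := conj (@ex_derive _ _ _ _ _ _ _ (fdh t y)) I in H)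
  G G0 intG Gub.
have Fc t : \int[lebn R n]_y f t y = \int[lebn R n]_y h y.
  rewrite /Rintegral; congr fine.
  apply: (@integral_lebn_shift _ _ (t *: evec R i) (EFin \o h)).
  exact/measurable_EFinP.
transitivity (\int[lebn R n]_y partial1of2 f 0 y).
  by apply: eq_Rintegral => y _; rewrite d1f scale0r addr0.
apply: (@cvg_unique R^o _ _ _ _ _ cvgF); first exact: Rhausdorff.
rewrite (_ : (fun t => _) = cst 0); first exact: cvg_cst.
by apply/funext => t; rewrite !Fc subrr scaler0.
Qed.
End divergence.

(** * Radial kernels *)

Section ball_geometry.
Variables (R : realType) (n : nat) (x : 'rV[R]_n) (r : R).
Hypothesis r0 : 0 < r.
Implicit Types (y : 'rV[R]_n) (i : 'I_n) (t s : R).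

Definition sqdist y : R := \sum_i (y 0 i - x 0 i) ^+ 2.

(** A polynomial in the coordinates, positive exactly on the open ball; its truncation [depth0] is
    the function p of the introductory comment. *)
Definition depth y : R := 1 - sqdist y / r ^+ 2.

Definition depth0 y : R := Num.max (depth y) 0.

Lemma sqdist_ge0 y : 0 <= sqdist y.
Proof. by apply: sumr_ge0 => i _; exact: sqr_ge0. Qed.

Lemma enormE y : enorm (y - x) = Num.sqrt (sqdist y).
Proof.
by congr Num.sqrt; apply: eq_bigr => i _; rewrite !mxE.
Qed.

Lemma enorm_lt y : (enorm (y - x) < r) = (sqdist y < r ^+ 2).
Proof.
rewrite enormE -[in LHS](@ger0_norm _ r) ?ltW// -sqrtr_sqr ltr_sqrt//.
by rewrite exprn_gt0.
Qed.

Lemma enorm_le y : (enorm (y - x) <= r) = (sqdist y <= r ^+ 2).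
Proof.
have rE : r = Num.sqrt (r ^+ 2) by rewrite sqrtr_sqr gtr0_norm.
by rewrite enormE [in LHS]rE ler_sqrt// exprn_ge0// ltW.
Qed.

Lemma eball_depth y : eball x r y <-> 0 < depth y.
Proof.
rewrite /eball/= enorm_lt /depth subr_gt0 ltr_pdivrMr ?exprn_gt0// mul1r.
by [].
Qed.

Lemma depth_le1 y : depth y <= 1.
Proof. by rewrite lerBlDr lerDl divr_ge0 ?sqdist_ge0// exprn_ge0// ltW. Qed.

Lemma depth0_in y : eball x r y -> depth0 y = depth y.
Proof. by move=> /eball_depth/ltW yB; rewrite /depth0 max_l. Qed.

Lemma depth0_out y : ~ eball x r y -> depth0 y = 0.
Proof. by move=> /eball_depth/negP; rewrite -leNgt => yB; rewrite /depth0 max_r. Qed.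

Lemma depth0_ge0 y : 0 <= depth0 y.
Proof. by rewrite /depth0 le_max lexx orbT. Qed.

Lemma depth0_le1 y : depth0 y <= 1.
Proof. by rewrite /depth0 ge_max depth_le1 ler01. Qed.

Lemma eball_sub_closed y : eball x r y -> eclosed_ball x r y.
Proof. exact: ltW. Qed.

Lemma eball_coord y i : eball x r y -> `|y 0 i - x 0 i| <= r.
Proof.
move=> yB; have /(_ i) : box n r (y - x).
  by apply: eball0_sub_box; rewrite /eball/= subr0.
by rewrite !mxE => /ltW.
Qed.

(** The homothety of centre [x] and ratio [s], which joins the constant map [x] at [s = 0] to the
    identity at [s = 1]. *)
Definition dil s y : 'rV[R]_n := x + s *: (y - x).

Lemma dil_coord s y i : dil s y 0 i = x 0 i + s * (y 0 i - x 0 i).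
Proof. by rewrite !mxE. Qed.

Lemma dil1 y : dil 1 y = y.
Proof. by rewrite /dil scale1r addrC subrK. Qed.

Lemma dil0 y : dil 0 y = x.
Proof. by rewrite /dil scale0r addr0. Qed.

Lemma sqdist_dil s y : sqdist (dil s y) = s ^+ 2 * sqdist y.
Proof.
rewrite /sqdist mulr_sumr; apply: eq_bigr => i _; rewrite dil_coord.
by rewrite addrAC subrr add0r exprMn.
Qed.

Lemma eball_dil s y : `|s| <= 1 -> eball x r y -> eball x r (dil s y).
Proof.
move=> s1; rewrite /eball/= !enorm_lt sqdist_dil; apply: le_lt_trans.
by rewrite ler_piMl ?sqdist_ge0// -real_normK ?num_real// expr_le1.
Qed.

Lemma continuous_sqdist : continuous sqdist.
Proof.
suff H (s : seq 'I_n) : continuous (fun y => \sum_(i <- s) (y 0 i - x 0 i) ^+ 2).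
  exact: H.
elim: s => [|i s IH] y.
  by rewrite (_ : (fun _ => _) = cst 0); [exact: cst_continuous|
    apply/funext => z; rewrite big_nil].
rewrite (_ : (fun _ => _) = (fun z : 'rV[R]_n => (z 0 i - x 0 i) * (z 0 i - x 0 i))
    + (fun z => \sum_(j <- s) (z 0 j - x 0 j) ^+ 2)); last first.
  by apply/funext => z; rewrite big_cons expr2.
apply: continuousD; last exact: IH.
have c1 : {for y, continuous (fun z : 'rV[R]_n => z 0 i - x 0 i)}.
  by apply: continuousB; [exact: coord_continuous|exact: cst_continuous].
exact: continuousM.
Qed.

Lemma measurable_depth0 : measurable_fun setT depth0.
Proof.
apply: measurable_maxr => //; apply: measurable_funB => //.
apply: measurable_funM => //; apply: measurable_sum => i; apply: measurable_funX.
by apply: measurable_funB => //; exact: measurable_coord.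
Qed.

Lemma compact_eclosed_ball : compact (eclosed_ball x r).
Proof.
apply: (@subclosed_compact _ _ [set y : 'rV[R]_n | forall i,
  `[x 0 i - r, x 0 i + r]%classic (y 0 i)]).
- rewrite (_ : eclosed_ball x r = sqdist @^-1` [set t | t <= r ^+ 2]).
    apply: (@preimage_closed _ _ sqdist [set t | t <= r ^+ 2]).
      by move=> y _; exact: continuous_sqdist.
    exact: closed_le.
  by apply/seteqP; split => y; rewrite /eclosed_ball/= enorm_le.
- apply: (@rV_compact R n (fun i => `[x 0 i - r, x 0 i + r]%classic)) => i.
  exact: segment_compact.
- move=> y; rewrite /eclosed_ball/= enorm_le => yr i /=.
  rewrite in_itv/= -ler_distl -(@ler_pXn2r _ 2)//; last by rewrite nnegrE ltW.
  rewrite real_normK ?num_real// (le_trans _ yr)// /sqdist (bigD1 i)//= lerDl.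
  by apply: sumr_ge0 => j _; exact: sqr_ge0.
Qed.

Lemma bounded_on_eclosed_ball (g : 'rV[R]_n -> R) :
  (forall y, eclosed_ball x r y -> {for y, continuous g}) ->
  exists2 C : R, 0 <= C & forall y, eclosed_ball x r y -> `|g y| <= C.
Proof.
move=> cg.
have : compact (g @` eclosed_ball x r).
  apply: continuous_compact; last exact: compact_eclosed_ball.
  apply: continuous_in_subspaceT => y /set_mem; exact: cg.
move=> /compact_bounded[M [Mr gM]].
exists (`|M| + 1); first by rewrite addr_ge0.
move=> y yB; apply: (gM (`|M| + 1)); last by exists y.
by rewrite (le_lt_trans (ler_norm M))// ltrDl.
Qed.

Lemma is_derive_depth y i :
  is_derive (0 : R) 1 (fun t => depth (y + t *: evec R i))
    (- (2 * (y 0 i - x 0 i)) / r ^+ 2).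
Proof.
have E t : depth (y + t *: evec R i) =
    depth y - (2 * (y 0 i - x 0 i) * t + t ^+ 2) / r ^+ 2.
  rewrite /depth; suff -> : sqdist (y + t *: evec R i) =
      sqdist y + (2 * (y 0 i - x 0 i) * t + t ^+ 2) by rewrite mulrDl opprD addrA.
  rewrite /sqdist (bigD1 i)//= [in RHS](bigD1 i)//= !mxE !eqxx/= mulr1.
  rewrite (eq_bigr (fun j => (y 0 j - x 0 j) ^+ 2)); last first.
    by move=> j ji; rewrite !mxE (negbTE ji) andbF mulr0 addr0.
  ring.
rewrite (funext E).
apply: is_derive_eq.
rewrite /= scaler0 scaler1.
by rewrite !scale0r !add0r addr0 mul1r [_ *: _]mulrC mulNr.
Qed.
End ball_geometry.

(** * Integration of functions supported in a ball *)

Section supported.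
Variables (R : realType) (n : nat) (x : 'rV[R]_n) (r : R).
Hypothesis r0 : 0 < r.
Local Notation mu := (lebn R n).
Local Notation B := (eball x r).
Implicit Types g h : 'rV[R]_n -> R.

Lemma integrable_eball g (C : R) : measurable_fun B g ->
  (forall y, B y -> `|g y| <= C) -> mu.-integrable B (EFin \o g).
Proof.
move=> mg gC; apply: measurable_bounded_integrable => //.
- exact: measurable_eball.
- exact: lebn_eball_lty.
- by exists C; split; [exact: num_real|move=> M CM y /gC /le_trans; apply; exact: ltW].
Qed.

Lemma patch_eball g : (forall y, ~ B y -> g y = 0) -> g \_ B = g.
Proof.
move=> g0; apply/funext => y; rewrite /patch; case: ifPn => // yB.
by rewrite g0// => /mem_set; rewrite (negbTE yB).
Qed.

Lemma measurable_supported g : (forall y, ~ B y -> g y = 0) ->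
  measurable_fun B g -> measurable_fun setT g.
Proof.
move=> g0 mg; rewrite -(patch_eball g0).
by apply/(measurable_restrictT _ _).1 => //; exact: measurable_eball.
Qed.

Lemma integrable_supported g (C : R) : (forall y, ~ B y -> g y = 0) ->
  measurable_fun B g -> (forall y, B y -> `|g y| <= C) ->
  mu.-integrable setT (EFin \o g).
Proof.
move=> g0 mg gC; have := integrable_eball mg gC.
move=> /(integrable_mkcond _ (measurable_eball x r)).1.
by rewrite restrict_EFin (patch_eball g0).
Qed.

Lemma Rintegral_supported g : (forall y, ~ B y -> g y = 0) ->
  \int[mu]_(y in B) g y = \int[mu]_y g y.
Proof. by move=> g0; rewrite Rintegral_mkcond (patch_eball g0). Qed.

(** Dominated convergence: constants are integrable because the ball has finite measure. *)
Lemma bounded_convergence_eball (g : nat -> 'rV[R]_n -> R) g0 (C : R) :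
  (forall k, measurable_fun B (g k)) -> measurable_fun B g0 ->
  (forall k y, B y -> `|g k y| <= C) ->
  {ae mu, forall y, B y -> g k y @[k --> \oo] --> g0 y} ->
  \int[mu]_(y in B) g k y @[k --> \oo] --> \int[mu]_(y in B) g0 y.
Proof.
move=> mg mg0 gC cg; have mB := measurable_eball x r.
have iC : mu.-integrable B (EFin \o cst C) by exact: (integrable_eball (C := `|C|)).
have cgE : {ae mu, forall y, B y ->
    (EFin \o g k) y @[k --> \oo] --> (EFin \o g0) y}.
  by apply: filterS cg => y + yB => /(_ yB) ?; apply: cvg_EFin => //; exact: nearW.
have gCE : {ae mu, forall y k, B y -> (`|(EFin \o g k) y| <= (EFin \o cst C) y)%E}.
  by apply: aeW => y k yB; rewrite lee_fin; exact: gC.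
have [ig0 _ dct] := @dominated_convergence _ _ R mu B mB (fun k => EFin \o g k)
  (EFin \o g0) (EFin \o cst C) (fun k => (measurable_EFinP _ _).2 (mg k))
  ((measurable_EFinP _ _).2 mg0) cgE iC gCE.
have fg0 := integrable_fin_num mB ig0.
by apply: fine_cvg; rewrite fineK.
Qed.

End supported.

Lemma Rintegral_sum (R : realType) d (T : measurableType d)
    (mu : {measure set T -> \bar R}) (D : set T) I (s : seq I) (g : I -> T -> R) :
  measurable D -> (forall i, mu.-integrable D (EFin \o g i)) ->
  \int[mu]_(y in D) (\sum_(i <- s) g i y) = \sum_(i <- s) \int[mu]_(y in D) g i y.
Proof.
move=> mD ig; elim: s => [|i s IH].
  rewrite big_nil (_ : (fun y => _) = cst 0).
    by rewrite Rintegral_cst// mul0r.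
  by apply/funext => y; rewrite big_nil.
rewrite big_cons -IH -RintegralD//.
  by apply: eq_Rintegral => y _; rewrite big_cons.
have := integrable_sum mD s (P := xpredT) (fun i _ => ig i).
by apply: eq_integrable => // y _; rewrite /= sumEFin.
Qed.

(** * Kernels [f (p y)] and the divergence of [f(p) (y - x)] *)

Section kernel.
Variables (R : realType) (n : nat) (x : 'rV[R]_n) (r : R).
Hypothesis r0 : 0 < r.
Local Notation mu := (lebn R n).
Local Notation B := (eball x r).
Local Notation p := (depth0 x r).
Variables (f df : R -> R) (M : R).
Hypothesis fdf : forall t : R, 0 <= t -> is_derive t 1 f (df t).
Hypothesis f0 : f 0 = 0.
Hypothesis df0 : df 0 = 0.
Hypothesis mdf : measurable_fun setT df.
Hypothesis fM : forall t, 0 <= t <= 1 -> `|f t| <= M.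
Hypothesis dfM : forall t, 0 <= t <= 1 -> `|df t| <= M.

Lemma kernel_M_ge0 : 0 <= M.
Proof. by rewrite (le_trans _ (@fM 0 _))// lexx ler01. Qed.

Lemma kernel_fM y : `|f (p y)| <= M.
Proof. by rewrite fM// depth0_ge0 depth0_le1. Qed.

Lemma kernel_dfM y : `|df (p y)| <= M.
Proof. by rewrite dfM// depth0_ge0 depth0_le1. Qed.

Lemma kernel_f_out y : ~ B y -> f (p y) = 0.
Proof. by move=> yB; rewrite depth0_out. Qed.

Lemma kernel_df_out y : ~ B y -> df (p y) = 0.
Proof. by move=> yB; rewrite depth0_out. Qed.

Lemma is_derive_kernel y i :
  is_derive (0 : R) 1 (fun t => f (p (y + t *: evec R i)))
    (df (p y) * (- (2 * (y 0 i - x 0 i)) / r ^+ 2)).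
Proof.
have d1 := is_derive_depth x r y i.
have E : depth x r (y + 0 *: evec R i) = depth x r y by rewrite scale0r addr0.
have d2 := is_derive_comp_max0 fdf df0 (depth x r (y + 0 *: evec R i)).
have := @is_derive1_comp R (fun s => f (Num.max s 0))
  (fun t => depth x r (y + t *: evec R i)) 0 _ _ d2 d1.
by rewrite E.
Qed.

Lemma measurable_kernel_f : measurable_fun setT (fun y => f (p y)).
Proof.
have mfm : measurable_fun [set: R] (fun t => f (Num.max t 0)).
  apply: continuous_measurable_fun => t.
  apply: differentiable_continuous; apply/derivable1_diffP.
  by have [] := is_derive_comp_max0 fdf df0 t.
rewrite (_ : (fun y => _) = (fun t => f (Num.max t 0)) \o p).
  exact: measurableT_comp mfm (measurable_depth0 x r).
by apply/funext => y /=; rewrite (max_l (depth0_ge0 _ _ _)).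
Qed.

Lemma measurable_kernel_df : measurable_fun setT (fun y => df (p y)).
Proof. exact: measurableT_comp mdf (measurable_depth0 x r). Qed.

(** The integrand is the divergence of [f(p) (y - x)]: in the ball the squares of the coordinates of
    [y - x] add up to [r^2 (1 - p)], which turns the derivative of the kernel into
    [- 2 (1 - p) df(p)]. *)
Lemma integral_kernel_div :
  \int[mu]_(y in B) (n%:R * f (p y) - 2 * (1 - p y) * df (p y)) = 0.
Proof.
have M0 := kernel_M_ge0.
pose z i (y : 'rV[R]_n) := y 0 i - x 0 i.
have mz i : measurable_fun setT (z i).
  by apply: measurable_funB => //; exact: measurable_coord.
have mf := measurable_kernel_f; have mdf' := measurable_kernel_df.
(* The partial derivative of [z i y * f (p y)] along the coordinate [i]. As [|z i y| <= r] in the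
   ball, its second term is at most [2 * M]. *)
pose dh i y := f (p y) + z i y * (df (p y) * (- (2 * z i y) / r ^+ 2)).
have mdh i : measurable_fun setT (dh i).
  apply: measurable_funD => //; apply: measurable_funM => //.
  apply: measurable_funM => //; apply: measurable_funM => //.
  by apply: measurableT_comp => //; exact: measurable_funM.
have dhB i y : `|dh i y| <= M + 2 * M.
  have [yB|yB] := pselect (B y); last first.
    rewrite /dh kernel_f_out// kernel_df_out// mul0r mulr0 addr0 normr0.
    by rewrite addr_ge0// mulr_ge0.
  rewrite (le_trans (ler_normD _ _))// lerD ?kernel_fM//.
  have zr := eball_coord i yB.
  rewrite (_ : z i y * _ = 2 * (- df (p y) * (z i y / r) ^+ 2)); last first.
    by field; rewrite gt_eqF.
  rewrite normrM ger0_norm// ler_wpM2l// normrM normrN -[leRHS]mulr1.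
  rewrite ler_pM// ?kernel_dfM// normrX exprn_ile1// normrM normfV.
  by rewrite (gtr0_norm r0) ler_pdivrMr// mul1r.
have dh0 i : \int[mu]_y dh i y = 0.
  apply: (@integral_partial_eq0 R n x r (M + 2 * M) i (fun y => z i y * f (p y))) => //.
  - exact: measurable_funM.
  - apply: (@integrable_supported _ _ x r r0 _ (r * M)).
    + by move=> y yB; rewrite kernel_f_out// mulr0.
    + by apply: measurable_funTS; exact: measurable_funM.
    + by move=> y yB; rewrite normrM ler_pM// ?kernel_fM//; exact: eball_coord.
  - move=> y.
    have d1 : is_derive (0 : R) 1 (fun t => z i (y + t *: evec R i)) 1.
      rewrite (_ : (fun t => _) = (fun t => z i y + t)); last first.
        by apply/funext => t; rewrite /z !mxE !eqxx mulr1 addrAC.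
      by apply: is_derive_eq; rewrite add0r mul1r.
    have d2 := is_derive_kernel y i.
    have := is_deriveM d1 d2; rewrite !scale0r !addr0 => d12.
    by apply: is_derive_eq d12 _; rewrite [_%:A]mulr1 addrC.
  - by move=> y yB; rewrite /dh kernel_f_out// kernel_df_out// mul0r mulr0 addr0.
have supp i y : ~ B y -> dh i y = 0.
  by move=> yB; rewrite /dh kernel_f_out// kernel_df_out// mul0r mulr0 addr0.
have mB := measurable_eball x r.
have idh i : mu.-integrable B (EFin \o dh i).
  apply: (@integrable_eball _ _ _ _ r0 _ (M + 2 * M)) => [|y _]; last exact: dhB.
  exact: measurable_funTS.
have H : \int[mu]_(y in B) (\sum_(i < n) dh i y) = 0.
  rewrite Rintegral_sum//; apply: big1 => i _.
  by rewrite Rintegral_supported//; exact: supp.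
rewrite -H; apply/esym; apply: eq_Rintegral => y /set_mem yB; rewrite big_split/=.
rewrite sumr_const card_ord -[f _ *+ n]mulr_natl; congr (_ + _).
rewrite (eq_bigr (fun i => - (2 * df (p y) / r ^+ 2) * z i y ^+ 2)); last first.
  by move=> i _; field; rewrite gt_eqF.
rewrite -mulr_sumr depth0_in// /depth /sqdist; field.
by rewrite gt_eqF.
Qed.
End kernel.

(** * Mean values of harmonic functions *)

Section directional.
Variables (R : realType) (n : nat).
Implicit Types (g : 'rV[R]_n -> R) (z v : 'rV[R]_n).

Lemma is_derive_line g z v : differentiable g z ->
  is_derive (0 : R) 1 (fun t => g (z + t *: v)) ('D_v g z).
Proof.
move=> dg; apply/is_derive_cvgP.
have cg : derivable g z v by exact: diff_derivable.
have cg' : (fun t => t^-1 *: (g (t *: v + z) - g z)) @ 0^' --> 'D_v g z by [].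
apply: cvg_trans cg'; apply: near_eq_cvg; near=> t.
by rewrite add0r scale0r addr0 (addrC z).
Unshelve. all: by end_near.
Qed.

Lemma derive_scale g z v (a : R) : differentiable g z ->
  'D_(a *: v) g z = a * 'D_v g z.
Proof. by move=> dg; rewrite !deriveE// linearZ. Qed.

Lemma derive_partial g z v : differentiable g z ->
  'D_v g z = \sum_(i < n) v 0 i * partial i g z.
Proof.
move=> dg; rewrite deriveE// [in LHS](row_sum_delta v) linear_sum.
by apply: eq_bigr => i _; rewrite linearZ /partial deriveE.
Qed.

Variable x : 'rV[R]_n.

Lemma is_derive_dil_coord g (s : R) y i : differentiable g (dil x s y) ->
  is_derive (0 : R) 1 (fun t => g (dil x s (y + t *: evec R i)))
    (s * partial i g (dil x s y)).
Proof.
move=> dg; rewrite -(derive_scale (evec R i) s dg).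
rewrite (_ : (fun t => _) = (fun t => g (dil x s y + t *: (s *: evec R i)))).
  exact: is_derive_line.
apply/funext => t; congr g; apply/rowP => j.
by rewrite !mxE; ring.
Qed.

Lemma is_derive_dil g (s : R) y : differentiable g (dil x s y) ->
  is_derive (s : R) (1 : R) (fun t : R => g (dil x t y))
    (\sum_(i < n) (y 0 i - x 0 i) * partial i g (dil x s y)).
Proof.
move=> dg; apply: is_derive_from0.
rewrite (_ : \sum_(i < n) _ = 'D_(y - x) g (dil x s y)); last first.
  by rewrite derive_partial//; apply: eq_bigr => i _; rewrite !mxE.
rewrite (_ : (fun t => _) = (fun t => g (dil x s y + t *: (y - x)))).
  exact: is_derive_line.
by apply/funext => t; rewrite /dil scalerDl addrA.
Qed.

Lemma continuous_dil (s : R) : continuous (dil x s).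
Proof.
move=> y; rewrite /continuous_at /dil.
have cB : (z - x) @[z --> y] --> y - x by exact: (cvgB cvg_id (cvg_cst x)).
exact: (cvgD (cvg_cst x) (cvgZl_tmp (k := s) cB)).
Qed.

End directional.

(** * Mean value property for the kernels [df (p y)] *)

Section harmonic.
Variables (R : realType) (n : nat) (D : set 'rV[R]_n) (u : 'rV[R]_n -> R).
Hypotheses (oD : open D) (C2u : C2_on D u) (hu : harmonic_on D u).
Variables (x : 'rV[R]_n) (r : R).
Hypotheses (r0 : 0 < r) (BD : eclosed_ball x r `<=` D).
Local Notation mu := (lebn R n).
Local Notation B := (eball x r).
Local Notation p := (depth0 x r).

Let BD' y : B y -> D y.
Proof. by move=> yB; apply: BD; exact: eball_sub_closed. Qed.

Let du y : D y -> differentiable u y. Proof. by case: C2u => + _; apply. Qed.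
Let dpu i y : D y -> differentiable (partial i u) y.
Proof. by case: C2u => _ [+ _]; apply. Qed.
Let cppu i j y : D y -> {for y, continuous (partial j (partial i u))}.
Proof.
move=> Dy; case: C2u => _ [_ /(_ i j)].
rewrite continuous_open_subspace// => /(_ y); apply; exact: mem_set.
Qed.

Let dilB s y : `|s| <= 1 -> B y -> D (dil x s y).
Proof. by move=> s1 yB; apply: BD'; exact: eball_dil. Qed.

Lemma measurable_dil (g : 'rV[R]_n -> R) (s : R) : `|s| <= 1 ->
  (forall y, D y -> {for y, continuous g}) -> measurable_fun B (fun y => g (dil x s y)).
Proof.
move=> s1 cg; apply: measurable_fun_continuous_on; first exact: measurable_eball.
move=> y yB; apply: (@continuous_comp _ _ _ (dil x s) g).
  exact: continuous_dil.
by apply: cg; exact: dilB.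
Qed.

Lemma bounded_dil (g : 'rV[R]_n -> R) : (forall y, D y -> {for y, continuous g}) ->
  exists2 C : R, 0 <= C &
    forall s y, `|s| <= 1 -> B y -> `|g (dil x s y)| <= C.
Proof.
move=> cg; have [|C C0 gC] := @bounded_on_eclosed_ball R n x r r0 g.
  by move=> y /BD; exact: cg.
by exists C => // s y s1 yB; apply: gC; apply: eball_sub_closed; exact: eball_dil.
Qed.

Variables (f df : R -> R) (M : R).
Hypothesis fdf : forall t : R, 0 <= t -> is_derive t 1 f (df t).
Hypothesis f0 : f 0 = 0.
Hypothesis df0 : df 0 = 0.
Hypothesis mdf : measurable_fun setT df.
Hypothesis fM : forall t, 0 <= t <= 1 -> `|f t| <= M.
Hypothesis dfM : forall t, 0 <= t <= 1 -> `|df t| <= M.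

Let M0 : 0 <= M. Proof. exact: kernel_M_ge0 fM. Qed.

(** The divergence of the field [f(p) grad u (dil x s y)] integrates to 0. It is [- 2 / r^2] times
    the integrand below plus [s f(p)] times the Laplacian of [u] at [dil x s y], which vanishes. *)
Lemma integral_kernel_radial (s : R) : `|s| <= 1 ->
  \int[mu]_(y in B)
    (df (p y) * \sum_(i < n) (y 0 i - x 0 i) * partial i u (dil x s y)) = 0.
Proof.
move=> s1.
have mB := measurable_eball x r.
have mf := measurable_kernel_f x r fdf df0.
have mdf' := measurable_kernel_df x r mdf.
pose z i (y : 'rV[R]_n) := y 0 i - x 0 i.
have mz i : measurable_fun setT (z i).
  by apply: measurable_funB => //; exact: measurable_coord.
pose v i y := partial i u (dil x s y).
have cv i y : D y -> {for y, continuous (partial i u)}.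
  by move=> Dy; exact/differentiable_continuous/dpu.
have mv i : measurable_fun B (v i) by apply: measurable_dil => // y; exact: cv.
pose dv i y := partial i (partial i u) (dil x s y).
have mdv i : measurable_fun B (dv i) by apply: measurable_dil => // y; exact: cppu.
have /choice[Cv Cvb] : forall i, exists C, 0 <= C /\ forall y, B y -> `|v i y| <= C.
  by move=> i; have [C C0 vC] := bounded_dil (@cv i); exists C; split => // y; exact: vC.
have /choice[Cdv Cdvb] : forall i, exists C, 0 <= C /\ forall y, B y -> `|dv i y| <= C.
  move=> i; have [C C0 vC] := bounded_dil (@cppu i i); exists C; split => // y.
  exact: vC.
(* [a i] and [b i] are the two terms of the product rule for [f (p y) * v i y]; the factor [s] in
   [b i] comes from differentiating through the homothety. *)
pose a i y := df (p y) * (- (2 * z i y) / r ^+ 2) * v i y.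
pose b i y := f (p y) * (s * dv i y).
have ma i : measurable_fun B (a i).
  apply: measurable_funM => //; apply: measurable_funTS.
  apply: measurable_funM => //; apply: measurable_funM => //.
  by apply: measurableT_comp => //; exact: measurable_funM.
have mb i : measurable_fun B (b i).
  apply: measurable_funM => //; first exact: measurable_funTS.
  exact: measurable_funM.
have aC i y : B y -> `|a i y| <= M * (2 / r) * Cv i.
  move=> yB; have [Cv0 vC] := Cvb i.
  rewrite /a !normrM ler_pM ?mulr_ge0//; last exact: vC.
  rewrite ler_pM// ?mulr_ge0//; first exact: (kernel_dfM _ r0).
  rewrite (_ : 2 / r = 2 * r * r ^- 2); last by field; rewrite gt_eqF.
  rewrite normrN normrM ger0_norm// normfV (ger0_norm (exprn_ge0 _ (ltW r0))).
  rewrite ler_pM2r ?invr_gt0 ?exprn_gt0// ler_wpM2l//.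
  exact: eball_coord.
have bC i y : B y -> `|b i y| <= M * Cdv i.
  move=> yB; have [Cdv0 vC] := Cdvb i.
  rewrite /b normrM ler_pM// ?(kernel_fM _ r0)// normrM -[leRHS]mul1r ler_pM//.
  exact: vC.
have ia i : mu.-integrable B (EFin \o a i) by apply: integrable_eball (aC i).
have ib i : mu.-integrable B (EFin \o b i) by apply: integrable_eball (bC i).
have supp i y : ~ B y -> a i y + b i y = 0.
  by move=> yB; rewrite /a /b (kernel_f_out r0)// (kernel_df_out r0)// !mul0r addr0.
have mab i : measurable_fun B (fun y => a i y + b i y) by exact: measurable_funD.
have abC i y : `|a i y + b i y| <= M * (2 / r) * Cv i + M * Cdv i.
  have [yB|yB] := pselect (B y).
    by rewrite (le_trans (ler_normD _ _))// lerD ?aC ?bC.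
  have [? _] := Cvb i; have [? _] := Cdvb i.
  by rewrite supp// normr0 addr_ge0// !mulr_ge0// ?invr_ge0 ltW.
have ab0 i : \int[mu]_(y in B) (a i y + b i y) = 0.
  rewrite (Rintegral_supported (supp i)).
  have [Cv0 vC] := Cvb i.
  have hout y : ~ B y -> f (p y) * v i y = 0.
    by move=> yB; rewrite (kernel_f_out r0)// mul0r.
  have mh : measurable_fun B (fun y => f (p y) * v i y).
    by apply: measurable_funM => //; exact: measurable_funTS.
  apply: (@integral_partial_eq0 R n x r _ i (fun y => f (p y) * v i y) _ r0
    _ _ _ _ (abC i) (supp i)).
  - exact: measurable_supported hout mh.
  - apply: (integrable_supported r0 hout mh (C := M * Cv i)) => y yB.
    by rewrite normrM ler_pM// ?(kernel_fM _ r0)//; exact: vC.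
  - exact: measurable_supported (supp i) (mab i).
  - move=> y; have d1 := is_derive_kernel x r fdf df0 y i.
    have [yB|yB] := pselect (B y).
      have d2 := is_derive_dil_coord i (dpu i (dilB s1 yB)).
      have := is_deriveM d1 d2; rewrite !scale0r !addr0 => d12.
      apply: is_derive_eq d12 _.
      by rewrite addrC [v i y *: _]mulrC.
    (* Off the ball [v i] has no known derivative. But [f (p _)] has value and derivative 0 at [y],
       and it dominates the product up to the bound [Cv i] of [v i] on the ball. *)
    rewrite supp//; apply: (@is_derive0_dominated _
      (fun t => f (p (y + t *: evec R i))) _ (Cv i)).
    + by rewrite scale0r addr0 (kernel_f_out r0).
    + by have := d1; rewrite (kernel_df_out r0)// mul0r.
    + move=> t; rewrite normrM mulrC.
      have [ytB|ytB] := pselect (B (y + t *: evec R i)).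
        by rewrite ler_wpM2r// vC.
      by rewrite (kernel_f_out r0 f0 ytB) normr0 !mulr0.
have : \int[mu]_(y in B) (\sum_(i < n) (a i y + b i y)) = 0.
  rewrite Rintegral_sum//; first by apply: big1 => i _; exact: ab0.
  by move=> i; apply: integrable_eball (fun y _ => abC i y).
rewrite (_ : \int[mu]_(y in B) (\sum_(i < n) (a i y + b i y)) =
   (- (2 / r ^+ 2)) * \int[mu]_(y in B)
    (df (p y) * \sum_(i < n) (y 0 i - x 0 i) * partial i u (dil x s y))).
  by move/eqP; rewrite mulf_eq0 oppr_eq0 mulf_eq0 invr_eq0 sqrf_eq0 (gt_eqF r0)
    pnatr_eq0/= => /eqP.
rewrite -RintegralZl//.
  apply: eq_Rintegral => y /set_mem yB; rewrite big_split/=.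
  rewrite [X in _ + X](_ : _ = 0) ?addr0; last first.
    rewrite -mulr_sumr -mulr_sumr.
    have := hu (dilB s1 yB); rewrite /laplacian /dv => ->.
    by rewrite !mulr0.
  rewrite !mulr_sumr; apply: eq_bigr => i _; rewrite /a /z /v; field.
  by rewrite gt_eqF.
apply: (integrable_eball r0 (C := M * \sum_(i < n) r * Cv i)).
  apply: measurable_funM; first exact: measurable_funTS.
  apply: measurable_sum => i; apply: measurable_funM; last exact: mv.
  exact: (measurable_funTS (mz i)).
move=> y yB; rewrite normrM ler_pM//; first exact: (kernel_dfM _ r0).
rewrite (le_trans (ler_norm_sum _ _ _))// ler_sum// => i _.
have [Cv0 vC] := Cvb i.
by rewrite normrM ler_pM//; [exact: eball_coord|exact: vC].
Qed.
(** [F s], the integral of [df(p) u (dil x s y)], has derivative 0 on []-1, 1[] by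
    [integral_kernel_radial], so [F s = F 0] for [0 < s < 1]. A limit yields [F 1 = F 0]: the bounds
    cover ratios up to 1 only, so [F] is not differentiated at 1. *)
Lemma integral_kernel_harmonic :
  \int[mu]_(y in B) (df (p y) * u y) = u x * \int[mu]_(y in B) df (p y).
Proof.
have mB := measurable_eball x r.
have mdf' : measurable_fun B (fun y => df (p y)).
  by apply: measurable_funTS; exact: measurable_kernel_df.
have cu y : D y -> {for y, continuous u}.
  by move=> Dy; exact/differentiable_continuous/du.
have [Cu Cu0 uC] := bounded_dil cu.
have cv i y : D y -> {for y, continuous (partial i u)}.
  by move=> Dy; exact/differentiable_continuous/dpu.
have /choice[Cv Cvb] : forall i, exists C, 0 <= C /\
    forall s y, `|s| <= 1 -> B y -> `|partial i u (dil x s y)| <= C.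
  by move=> i; have [C C0 vC] := bounded_dil (@cv i); exists C.
pose phi s y := df (p y) * u (dil x s y).
have mphi s : `|s| <= 1 -> measurable_fun B (phi s).
  by move=> s1; apply: measurable_funM => //; exact: measurable_dil.
have phiC s y : `|s| <= 1 -> B y -> `|phi s y| <= M * Cu.
  by move=> s1 yB; rewrite normrM ler_pM// ?(kernel_dfM _ r0)// uC.
have iphi s : `|s| <= 1 -> mu.-integrable B (EFin \o phi s).
  by move=> s1; apply: integrable_eball (fun y => phiC s y s1) => //; exact: mphi.
pose F s := \int[mu]_(y in B) phi s y.
have I1 (s : R) : `]-1, 1[%classic s -> `|s| <= 1.
  by rewrite /= in_itv/= -ltr_norml => /ltW.
pose dphi s y := df (p y) * \sum_(i < n) (y 0 i - x 0 i) * partial i u (dil x s y).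
have phidphi (s : R) y : `|s| <= 1 -> B y -> is_derive s 1 (phi ^~ y) (dphi s y).
  move=> s1 yB; have d1 := is_derive_dil (du (dilB s1 yB)).
  exact: (is_deriveZ (df (p y)) d1).
pose K : R := M * \sum_(i < n) r * Cv i.
have dphiK (s : R) y : `|s| <= 1 -> B y -> `|dphi s y| <= K.
  move=> s1 yB; rewrite normrM ler_pM//; first exact: (kernel_dfM _ r0).
  rewrite (le_trans (ler_norm_sum _ _ _))// ler_sum// => i _.
  have [Cv0 vC] := Cvb i.
  by rewrite normrM ler_pM//; [exact: eball_coord|exact: vC].
have K0 : 0 <= K.
  rewrite mulr_ge0// sumr_ge0// => i _; have [? _] := Cvb i.
  by rewrite mulr_ge0// ltW.
have iK : mu.-integrable B (EFin \o cst K).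
  by apply: (integrable_eball r0 (C := `|K|)).
have dF (s : R) : `]-1, 1[%classic s -> is_derive s 1 F 0.
  move=> Is.
  have := @cvg_differentiation_under_integral R _ _ mu phi B mB s (-1) 1 Is
    (fun t It => iphi t (I1 t It))
    (fun t y It yB => @ex_derive _ _ _ _ _ _ _ (phidphi t y (I1 t It) yB))
    (cst K) (fun _ => K0) iK _.
  have E t y : `]-1, 1[%classic t -> B y -> partial1of2 phi t y = dphi t y.
    by move=> /I1 t1 yB; rewrite partial1of2E; have [] := phidphi t y t1 yB.
  have H t y : `]-1, 1[%classic t -> B y -> `|partial1of2 phi t y| <= cst K y.
    by move=> It yB; rewrite E// dphiK//; exact: I1.
  move=> /(_ H).
  have -> : \int[mu]_(y in B) partial1of2 phi s y = 0.
    rewrite -(integral_kernel_radial (I1 s Is)).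
    by apply: eq_Rintegral => y /set_mem yB; rewrite E.
  move=> cF; apply/is_derive_cvgP; apply: cvg_trans cF.
  by apply: near_eq_cvg; near=> t; rewrite (addrC s).
have Fc (s : R) : 0 < s < 1 -> F s = F 0.
  move=> /andP[s0 s1].
  have sI (t : R) : 0 <= t <= s -> `]-1, 1[%classic t.
    rewrite /= in_itv/= => /andP[t0 ts].
    by rewrite (lt_le_trans _ t0)//= (le_lt_trans ts).
  have dF0 t : t \in `]0, s[ -> is_derive t 1 F ((fun=> 0) t).
    rewrite in_itv/= => /andP[/ltW t0 /ltW ts]; apply: dF; apply: sI.
    by rewrite t0.
  have cF : {within `[0, s], continuous F}.
    apply: continuous_in_subspaceT => t /set_mem /=; rewrite in_itv/= => /sI/dF[dFt _].
    exact/differentiable_continuous/derivable1_diffP.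
  have [c _] := MVT_segment (ltW s0) dF0 cF.
  by rewrite mul0r => /eqP; rewrite subr_eq0 => /eqP.
(* Ratios increasing to 1; [k.+2] instead of [k.+1] keeps the first one positive. *)
pose sk (k : nat) : R := 1 - k.+2%:R^-1.
have sk01 k : 0 < sk k < 1.
  by rewrite subr_gt0 invf_lt1// ltr1n/= ltrBlDr ltrDl invr_gt0 ltr0n.
have sk1 k : `|sk k| <= 1.
  by have /andP[s0 /ltW s1] := sk01 k; rewrite ger0_norm// ltW.
have skc : sk k @[k --> \oo] --> (1 : R).
  rewrite -[X in _ --> X]subr0; apply: cvgB; first exact: cvg_cst.
  have := @cvg_harmonic R; rewrite -(cvg_shiftS (@harmonic R)).
  exact.
have n1 : `|1 : R| <= 1 by rewrite normr1.
have cphi : {ae mu, forall y, B y -> phi (sk k) y @[k --> \oo] --> phi 1 y}.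
  apply: aeW => y yB.
  have c1 : {for (1 : R), continuous (phi ^~ y)}.
    have [d1 _] := phidphi 1 y n1 yB.
    exact/differentiable_continuous/derivable1_diffP.
  exact: (cvg_comp _ _ skc c1).
have cF1 := bounded_convergence_eball r0 (fun k => mphi _ (sk1 k)) (mphi _ n1)
  (fun k y => phiC _ y (sk1 k)) cphi.
have F01 : F 0 = F 1.
  apply: (cvg_unique _ _ cF1) => //.
  rewrite (_ : (fun k => _) = cst (F 0)); first exact: cvg_cst.
  by apply/funext => k; rewrite -(Fc (sk k)).
transitivity (F 1).
  by apply: eq_Rintegral => y _; rewrite /phi dil1.
rewrite -F01 -RintegralZl//.
  by apply: eq_Rintegral => y _; rewrite /phi dil0 mulrC.
apply: (integrable_eball r0 (C := M)) => // y _; exact: kernel_dfM.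
Unshelve. all: by end_near.
Qed.
End harmonic.

(** * The logarithmic kernel *)

Section log_series.
Variable R : realType.
Implicit Types t : R.

(** Partial sums of the Taylor series of [- ln (1 - t)] at 0. *)
Definition logsum N t : R := \sum_(k < N) t ^+ k.+1 / k.+1%:R.

Lemma logsum_ge0 N t : 0 <= t -> 0 <= logsum N t.
Proof. by move=> t0; apply: sumr_ge0 => k _; rewrite divr_ge0// exprn_ge0. Qed.

Lemma logsum_nondecreasing t : 0 <= t ->
  {homo (logsum ^~ t) : N K / (N <= K)%N >-> N <= K}.
Proof.
move=> t0; apply: homo_leq => [//|? ? ? /le_trans|N]; first exact.
by rewrite /logsum big_ord_recr/= lerDl divr_ge0// exprn_ge0.
Qed.

Lemma is_derive_expn k t :
  is_derive t 1 (fun s => s ^+ k.+1) (k.+1%:R * t ^+ k).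
Proof.
have d := @is_deriveX R R id k.+1 t 1 1 (is_derive_id t 1).
rewrite (_ : (fun s : R => s ^+ k.+1) = id ^+ k.+1).
  by apply: is_derive_eq d _; rewrite [_ *: 1]mulr1.
by apply/funext => s; rewrite fctE.
Qed.

Lemma is_derive_logsum N t :
  is_derive t 1 (logsum N) (\sum_(k < N) t ^+ k).
Proof.
rewrite (_ : logsum N = \sum_(k < N) (fun t => t ^+ k.+1 / k.+1%:R)); last first.
  by apply/funext => s; rewrite fct_sumE.
apply: is_derive_sum => k.
rewrite (_ : (fun t => _) = k.+1%:R^-1 \*: (fun t => t ^+ k.+1)); last first.
  by apply/funext => s; rewrite mulrC.
apply: is_derive_eq (is_deriveZ k.+1%:R^-1 (is_derive_expn k t)) _.
by rewrite [_ *: _]mulKf// pnatr_eq0.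
Qed.

(** The remainder vanishes at 0 and, by the geometric sum, has derivative [s^N / (1 - s)]. The mean
    value theorem writes it as [t c^N / (1 - c)] with [0 <= c <= t], which increases with [c]. *)
Lemma logsum_remainder N t : 0 <= t < 1 ->
  0 <= - ln (1 - t) - logsum N t <= t ^+ N.+1 / (1 - t).
Proof.
move=> /andP[t0 t1].
pose g (s : R) := - ln (1 - s) - logsum N s.
have dg (s : R) : s < 1 -> is_derive s 1 g (s ^+ N / (1 - s)).
  move=> s1; have d1 := is_derive_logsum N s.
  have s1' : 0 < 1 - s by rewrite subr_gt0.
  have d2 := is_derive1_ln s1'.
  have d3 : is_derive s 1 (fun s : R => 1 - s) (-1).
    by apply: is_derive_eq; rewrite add0r mul1r.
  have d4 := @is_derive1_comp R (@ln R) (fun s => 1 - s) s _ _ d2 d3.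
  have := is_deriveB (is_deriveN d4) d1 => d5; apply: is_derive_eq d5 _.
  have E : (\sum_(k < N) s ^+ k) * (1 - s) = 1 - s ^+ N.
    by rewrite mulrC -(opprB s) mulNr -subrX1 opprB.
  rewrite mulrN1 opprK; apply: (mulIf (lt0r_neq0 s1')).
  rewrite divfK ?lt0r_neq0// mulrBl mulVf ?lt0r_neq0// E; ring.
have dg0 (s : R) : s \in `]0, t[ -> is_derive s 1 g ((fun s => s ^+ N / (1 - s)) s).
  by rewrite in_itv/= => /andP[_ st]; apply: dg; exact: lt_trans t1.
have cg : {within `[0, t], continuous g}.
  apply: continuous_in_subspaceT => s /set_mem /=; rewrite in_itv/= => /andP[_ st].
  have [d _] := dg s (le_lt_trans st t1).
  exact/differentiable_continuous/derivable1_diffP.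
have [c] := MVT_segment t0 dg0 cg.
rewrite in_itv/= => /andP[c0 ct].
have -> : g 0 = 0.
  rewrite /g subr0 ln1 oppr0 sub0r /logsum big1 ?oppr0// => k _.
  by rewrite expr0n mul0r.
rewrite !subr0 /g => ->.
have t1' : 0 < 1 - t by rewrite subr_gt0.
have c1 : 0 < 1 - c by rewrite subr_gt0 (le_lt_trans ct).
rewrite !mulr_ge0 ?exprn_ge0 ?invr_ge0 ?(ltW c1)//=.
rewrite exprSr -[leLHS]mulrA -[leRHS]mulrA [t / _]mulrC.
rewrite ler_pM ?exprn_ge0 ?mulr_ge0 ?invr_ge0 ?(ltW c1)//.
  by rewrite lerXn2r// nnegrE.
by rewrite ler_wpM2r// lef_pV2 ?posrE// lerB.
Qed.

Lemma logsum_le N t : 0 <= t < 1 -> logsum N t <= - ln (1 - t).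
Proof. by move=> /(logsum_remainder N)/andP[]; rewrite subr_ge0. Qed.

Lemma logsum_cvg t : 0 <= t < 1 -> logsum N t @[N --> \oo] --> - ln (1 - t).
Proof.
move=> t01; have /andP[t0 t1] := t01.
have c0 : t ^+ N.+1 / (1 - t) @[N --> \oo] --> (0 : R).
  rewrite -[X in _ --> X](mul0r (1 - t)^-1); apply: cvgM; last exact: cvg_cst.
  have := @cvg_expr R t; rewrite ger0_norm// => /(_ t1).
  by rewrite -(cvg_shiftS (fun N => t ^+ N)).
have c1 : - ln (1 - t) - logsum N t @[N --> \oo] --> (0 : R).
  apply: (squeeze_cvgr _ (cvg_cst 0) c0); apply: nearW => N; exact: logsum_remainder.
rewrite -[X in _ --> X]subr0.
rewrite (_ : logsum ^~ t = (fun N => - ln (1 - t) - (- ln (1 - t) - logsum N t))).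
  by apply: cvgB => //; exact: cvg_cst.
by apply/funext => N; rewrite opprB addrC subrK.
Qed.

End log_series.

(** * Moments of [p] over the ball *)

Section moments.
Variables (R : realType) (n : nat) (x : 'rV[R]_n) (r : R).
Hypothesis r0 : 0 < r.
Local Notation mu := (lebn R n).
Local Notation B := (eball x r).
Local Notation p := (depth0 x r).

Definition moment k : R := \int[mu]_(y in B) (p y ^+ k).

Lemma measurable_depth0X k : measurable_fun B (fun y => p y ^+ k).
Proof.
by apply: measurable_funTS; apply: measurable_funX; exact: measurable_depth0.
Qed.

Lemma integrable_depth0X k : mu.-integrable B (EFin \o (fun y => p y ^+ k)).
Proof.
apply: (integrable_eball r0 (C := 1)); first exact: measurable_depth0X.
by move=> y _; rewrite normrX exprn_ile1// ger0_norm ?depth0_ge0// depth0_le1.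
Qed.

(** This is [integral_kernel_div] for the kernel [t^(k+1)]; the condition that its derivative
    vanishes at 0 fails only for [k = 0]. *)
Lemma integral_moment_rec k :
  \int[mu]_(y in B) (n%:R * p y ^+ k.+1 - 2 * (1 - p y) * (k.+1%:R * p y ^+ k)) = 0.
Proof.
have bnd (j : nat) (t : R) : 0 <= t <= 1 -> `|t ^+ j| <= 1.
  by move=> /andP[t0 t1]; rewrite normrX exprn_ile1// ger0_norm.
case: k => [|k].
  (* [depth0] itself is not C^1 across the sphere: take the limit of
     [f j t = t - t / (1 + j t)] as [j] goes to infinity. *)
  pose f (j : nat) (t : R) := t - t / (1 + j%:R * t).
  (* [1 - (1 + j t)^-2] on the half-line [0 <= t], in a form that is measurable
     on the whole line. *)
  pose df (j : nat) (t : R) := 1 - expR (- (2 * ln (1 + j%:R * t))).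
  have jt j (t : R) : 0 <= t -> 1 <= 1 + j%:R * t by move=> t0; rewrite lerDl mulr_ge0.
  have jt0 j (t : R) : 0 <= t -> 0 < 1 + j%:R * t by move=> /(jt j); exact: lt_le_trans.
  have dfE j (t : R) : 0 <= t -> df j t = 1 - (1 + j%:R * t) ^- 2.
    by move=> /(jt0 j) jt1; rewrite /df expRN expRM_natl lnK.
  have fdf j (t : R) : 0 <= t -> is_derive t 1 (f j) (df j t).
    move=> t0; rewrite dfE//; have nz : 1 + j%:R * t != 0 by rewrite gt_eqF// jt0.
    have sc (a b : R) : a *: b = a * b by [].
    by apply: is_derive_eq; rewrite !sc; field.
  have q01 j (t : R) : 0 <= t -> 0 <= (1 + j%:R * t)^-1 <= 1.
    move=> t0; rewrite invr_ge0 ltW ?jt0//= invf_le1 ?jt0//; exact: jt.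
  have fM j (t : R) : 0 <= t <= 1 -> `|f j t| <= 1.
    move=> /andP[t0 t1]; have /andP[q0 q1] := q01 j t t0.
    have -> : f j t = t * (1 - (1 + j%:R * t)^-1) by rewrite mulrBr mulr1.
    rewrite normrM !ger0_norm ?subr_ge0// mulr_ile1 ?subr_ge0// gerBl//.
  have dfM j (t : R) : 0 <= t <= 1 -> `|df j t| <= 1.
    move=> /andP[t0 t1]; have /andP[q0 q1] := q01 j t t0.
    rewrite dfE// -exprVn ger0_norm ?gerBl ?exprn_ge0//.
    by rewrite subr_ge0 exprn_ile1.
  have mdf j : measurable_fun setT (df j).
    apply: measurable_funB => //; apply: (measurableT_comp (@measurable_expR R)).
    apply: measurableT_comp => //; apply: measurable_funM => //.
    apply: (measurableT_comp (@measurable_ln R)).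
    by apply: measurable_funD => //; exact: measurable_funM.
  have f0 j : f j 0 = 0 by rewrite /f mul0r subr0.
  have df0 j : df j 0 = 0 by rewrite dfE// mulr0 addr0 expr1n invr1 subrr.
  (* The shift to [j.+1] allows comparison with the harmonic sequence [1 / j.+1]. *)
  pose g (j : nat) y := n%:R * f j.+1 (p y) - 2 * (1 - p y) * df j.+1 (p y).
  have g0 j : \int[mu]_(y in B) g j y = 0.
    exact: (integral_kernel_div x r0 (fdf j.+1) (f0 _) (df0 _) (mdf _) (fM _) (dfM _)).
  have mp := @measurable_depth0 R n x r.
  have mg j : measurable_fun B (g j).
    apply: measurable_funTS; apply: measurable_funB.
      by apply: measurable_funM => //; exact: (measurable_kernel_f x r (fdf j.+1)).
    apply: measurable_funM; last exact: measurable_kernel_df.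
    by apply: measurable_funM => //; exact: measurable_funB.
  have mg0 : measurable_fun B
      (fun y => n%:R * p y ^+ 1 - 2 * (1 - p y) * (1 * p y ^+ 0)).
    apply: measurable_funTS; apply: measurable_funB.
      by apply: measurable_funM => //; exact: measurable_funX.
    apply: measurable_funM; last by apply: measurable_funM => //; exact: measurable_funX.
    by apply: measurable_funM => //; exact: measurable_funB.
  have gC j y : B y -> `|g j y| <= n%:R + 2.
    move=> _; have p01 : 0 <= p y <= 1 by rewrite depth0_ge0 depth0_le1.
    rewrite (le_trans (ler_normB _ _))// lerD//.
      by rewrite normrM ger0_norm// -[leRHS]mulr1 ler_wpM2l// fM.
    rewrite -mulrA normrM ger0_norm// -[leRHS]mulr1 ler_wpM2l// normrM.
    rewrite mulr_ile1// ?dfM// ger0_norm ?subr_ge0 ?gerBl; by case/andP: p01.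
  have cg : {ae mu, forall y, B y -> g j y @[j --> \oo] -->
      n%:R * p y ^+ 1 - 2 * (1 - p y) * (1 * p y ^+ 0)}.
    apply: aeW => y yB.
    (* Convergence relies on the ball being open: [df j (p y)] tends to 1 where [p y > 0], but stays
       0 where [p y = 0]. *)
    have p0 : 0 < p y by rewrite depth0_in//; exact/eball_depth.
    have cq : (1 + j.+1%:R * p y)^-1 @[j --> \oo] --> (0 : R).
      have ch : (p y)^-1 * j.+1%:R^-1 @[j --> \oo] --> (0 : R).
        rewrite -[X in _ --> X](mulr0 (p y)^-1).
        by apply: cvgM; [exact: cvg_cst|exact: cvg_harmonic].
      apply: (squeeze_cvgr _ (cvg_cst 0) ch); apply: nearW => j.
      have /andP[-> _] := q01 j.+1 (p y) (ltW p0).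
      rewrite -invfM lef_pV2 ?posrE ?jt0 ?(ltW p0)//; last by rewrite mulr_gt0// ltr0n.
      by rewrite /= [leLHS]mulrC lerDr ler01.
    apply: cvgB.
      apply: cvgM; first exact: cvg_cst.
      rewrite expr1 -[X in _ --> X]subr0; apply: cvgB; first exact: cvg_cst.
      by rewrite -[X in _ --> X](mulr0 (p y)); apply: cvgM => //; exact: cvg_cst.
    apply: cvgM; first exact: cvg_cst.
    rewrite expr0 mulr1 -[X in _ --> X]subr0.
    rewrite (_ : (fun j => _) = (fun j => 1 - (1 + j.+1%:R * p y) ^- 2)); last first.
      by apply/funext => j; rewrite dfE// ltW.
    apply: cvgB; first exact: cvg_cst.
    rewrite (_ : (fun j => _) =
        (fun j => (1 + j.+1%:R * p y)^-1 * (1 + j.+1%:R * p y)^-1)).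
      by rewrite -[X in _ --> X](mulr0 0); exact: cvgM.
    by apply/funext => j; rewrite expr2 invfM.
  have cI := bounded_convergence_eball r0 mg mg0 gC cg.
  apply/esym; apply: (cvg_unique _ _ cI) => //.
  rewrite (_ : (fun k => _) = cst 0); first exact: cvg_cst.
  by apply/funext => j; exact: g0.
have := @integral_kernel_div R n x r r0 (fun t => t ^+ k.+2)
  (fun t => k.+2%:R * t ^+ k.+1) k.+2%:R (fun t _ => is_derive_expn k.+1 t).
apply.
- by rewrite expr0n.
- by rewrite expr0n mulr0.
- by apply: measurable_funM => //; exact: measurable_funX.
- by move=> t t01; rewrite (le_trans (bnd _ _ t01))// ler1n.
- move=> t t01; rewrite normrM ger0_norm// -[leRHS]mulr1 ler_wpM2l//; exact: bnd.
Qed.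

(** The recurrence is solved for the difference of consecutive moments, so that the sum over [k]
    telescopes. *)
Lemma moment_rec k : moment k - moment k.+1 = n%:R / 2 * (moment k.+1 / k.+1%:R).
Proof.
have mB := measurable_eball x r.
have := integral_moment_rec k.
have -> : \int[mu]_(y in B)
     (n%:R * p y ^+ k.+1 - 2 * (1 - p y) * (k.+1%:R * p y ^+ k)) =
   \int[mu]_(y in B) ((n%:R + 2 * k.+1%:R) * p y ^+ k.+1 - 2 * k.+1%:R * p y ^+ k).
  by apply: eq_Rintegral => y _; rewrite exprS; ring.
have iZ (c : R) j : mu.-integrable B (EFin \o (fun y => c * p y ^+ j)).
  by have := integrableZl mB c (integrable_depth0X j); apply: eq_integrable.
rewrite RintegralB// !RintegralZl//; try exact: integrable_depth0X.
rewrite -/(moment k) -/(moment k.+1) => E.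
have k0 : k.+1%:R != 0 :> R by rewrite pnatr_eq0.
apply: (mulfI k0); apply: (@mulfI _ 2); first by rewrite pnatr_eq0.
apply/eqP; rewrite -subr_eq0; apply/eqP.
by rewrite -[RHS]oppr0 -E; field.
Qed.

Lemma moment_sum N :
  \sum_(k < N) moment k.+1 / k.+1%:R * n%:R = 2 * (moment 0 - moment N).
Proof.
elim: N => [|N IH]; first by rewrite big_ord0 subrr mulr0.
rewrite big_ord_recr/= IH.
have -> : moment N.+1 / N.+1%:R * n%:R = 2 * (moment N - moment N.+1).
  by rewrite moment_rec; field.
ring.
Qed.

Lemma moment0 : (moment 0)%:E = mu B.
Proof.
rewrite /moment /Rintegral (eq_integral (cst 1%E)).
  rewrite integral_cst; last exact: measurable_eball.
  rewrite mul1e fineK// ge0_fin_numE//; exact: lebn_eball_lty.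
by move=> y _; rewrite expr0.
Qed.

End moments.

(** * Summation of the logarithmic series *)

Section log_kernel.
Variables (R : realType) (n' : nat).
(** A positive dimension makes points null sets and permits division by [n]. *)
Local Notation n := n'.+1.
Variables (x : 'rV[R]_n) (r : R).
Hypothesis r0 : 0 < r.
Local Notation mu := (lebn R n).
Local Notation B := (eball x r).
Local Notation p := (depth0 x r).
Local Notation L := (fun y => - ln (1 - p y)).

Lemma depth0_lt1 y : y <> x -> p y < 1.
Proof.
move=> yx; rewrite /depth0 gt_max ltr01 andbT ltrBlDr ltrDl divr_gt0// ?exprn_gt0//.
rewrite lt_neqAle sqdist_ge0 andbT eq_sym; apply/eqP => s0; apply: yx.
apply/rowP => i; apply/eqP; rewrite -subr_eq0 -sqrf_eq0; apply/eqP.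
apply: (psumr_eq0P _ s0) => // j _; exact: sqr_ge0.
Qed.

(* Also true at [y = x], where both sides are [0]: [r / 0 = 0] and [ln 0 = 0]. *)
Lemma ln_enorm y : B y -> ln (r / enorm (x - y)) = L y / 2.
Proof.
move=> yB; rewrite /= depth0_in//.
have -> : 1 - depth x r y = sqdist x y / r ^+ 2 by rewrite /depth opprB addrC subrK.
have -> : enorm (x - y) = Num.sqrt (sqdist x y).
  by congr Num.sqrt; apply: eq_bigr => i _; rewrite !mxE -sqrrN opprB.
have := sqdist_ge0 x y; rewrite le_eqVlt => /orP[/eqP <-|q0].
  by rewrite sqrtr0 invr0 mulr0 mul0r ln0// oppr0 mul0r.
have e0 : 0 < Num.sqrt (sqdist x y) by rewrite sqrtr_gt0.
rewrite -{2}(sqr_sqrtr (ltW q0)) -expr_div_n -[_ / r]invf_div exprVn.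
rewrite lnV ?posrE ?exprn_gt0 ?divr_gt0// lnXn ?divr_gt0// opprK -[ln _ *+ 2]mulr_natr.
by rewrite mulfK// pnatr_eq0.
Qed.

(** At the centre [p] equals 1: there the powers of [p] do not tend to 0 and the logarithmic series
    diverges. *)
Lemma ae_neq : {ae mu, forall y, y <> x}.
Proof.
exists [set x]; split; [exact: measurable_rV_set1|exact: lebn_set1|].
by move=> y /= /contrapT.
Qed.

Lemma moment_cvg0 : moment x r N @[N --> \oo] --> (0 : R).
Proof.
have mB := measurable_eball x r.
have -> : 0 = \int[mu]_(y in B) (cst 0 y) :> R by rewrite Rintegral_cst// mul0r.
apply: (bounded_convergence_eball r0 (C := 1)) => //.
- by move=> k; exact: measurable_depth0X.
- by move=> k y _; rewrite normrX exprn_ile1// ger0_norm ?depth0_ge0// depth0_le1.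
- apply: filterS ae_neq => y yx _; apply: cvg_expr.
  by rewrite ger0_norm ?depth0_ge0// depth0_lt1.
Qed.

Lemma measurable_logsum N : measurable_fun B (fun y => logsum N (p y)).
Proof.
apply: measurable_sum => k; apply: measurable_funM => //.
exact: measurable_depth0X.
Qed.

Lemma integrable_logsum N : mu.-integrable B (EFin \o (fun y => logsum N (p y))).
Proof.
apply: (integrable_eball r0 (C := logsum N 1)); first exact: measurable_logsum.
move=> y _; rewrite ger0_norm ?logsum_ge0 ?depth0_ge0//.
apply: ler_sum => k _; rewrite ler_wpM2r// expr1n exprn_ile1 ?depth0_ge0//.
exact: depth0_le1.
Qed.

Lemma integral_logsum N :
  \int[mu]_(y in B) logsum N (p y) = 2 / n%:R * (moment x r 0 - moment x r N).
Proof.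
have mB := measurable_eball x r.
rewrite Rintegral_sum// => [|k]; last first.
  have := integrableZl mB k.+1%:R^-1 (integrable_depth0X x r0 k.+1).
  by apply: eq_integrable => // y _; rewrite /= -EFinM mulrC.
have n0 : n%:R != 0 :> R by rewrite pnatr_eq0.
apply: (mulIf n0); rewrite mulrAC divfK// -moment_sum// mulr_suml.
apply: eq_bigr => k _; congr (_ * _); rewrite RintegralZr//.
exact: integrable_depth0X.
Qed.

Lemma depth0_01 y : y <> x -> 0 <= p y < 1.
Proof. by move=> yx; rewrite depth0_ge0 depth0_lt1. Qed.

Lemma log_kernel_ge0 y : 0 <= L y.
Proof.
by rewrite /= oppr_ge0 ln_le0// gerBl depth0_ge0.
Qed.

Lemma measurable_log_kernel : measurable_fun B L.
Proof.
apply: measurable_funTS; apply: measurableT_comp => //.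
apply: (measurableT_comp (@measurable_ln R)).
by apply: measurable_funB => //; exact: measurable_depth0.
Qed.

(** Monotone convergence for the partial sums, whose integrals are bounded by [integral_logsum]. *)
Lemma integrable_log_kernel : mu.-integrable B (EFin \o L).
Proof.
have mB := measurable_eball x r.
apply/integrableP; split; first by apply/measurable_EFinP; exact: measurable_log_kernel.
pose g N y := (logsum N (p y))%:E.
have mg N : measurable_fun B (g N).
  by apply/measurable_EFinP; exact: measurable_logsum.
have g0 N y : B y -> (0 <= g N y)%E by rewrite lee_fin logsum_ge0// depth0_ge0.
have ndg y : B y -> {homo g ^~ y : N K / (N <= K)%N >-> (N <= K)%E}.
  by move=> _ N K NK; rewrite lee_fin logsum_nondecreasing// depth0_ge0.
have cg y : B y -> cvgn (g ^~ y).
  by move=> yB; apply: ereal_nondecreasing_is_cvgn => N K; exact: ndg.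
have mlim : measurable_fun B (fun y => limn (g ^~ y)).
  by apply: (emeasurable_fun_cvg g) => // y yB; exact: cg.
(* The limit of the partial sums is [L y] off the centre only; at [x] it is infinite, whereas the
   default value [ln 0 = 0] makes [L x] vanish. *)
apply: (@le_lt_trans _ _ (\int[mu]_(y in B) limn (g ^~ y))%E).
  apply: ae_ge0_le_integral => //.
  - apply: measurableT_comp => //.
    by apply/measurable_EFinP; exact: measurable_log_kernel.
  - move=> y yB; apply: lime_ge; first exact: cg.
    by apply: nearW => N; exact: g0.
  - apply: filterS ae_neq => y yx yB.
    rewrite gee0_abs ?lee_fin ?log_kernel_ge0// (_ : limn _ = (L y)%:E)//.
    apply/cvg_lim => //; apply: cvg_EFin; first exact: nearW.
    by apply: logsum_cvg; exact: depth0_01.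
rewrite monotone_convergence//.
(* The integral of the partial sum is [2 / n] times the difference of the moments 0 and [N];
   dropping the nonnegative moment [N] gives a bound uniform in [N]. *)
apply: (@le_lt_trans _ _ (2 / n%:R * moment x r 0)%:E); last exact: ltry.
apply: lime_le.
  by have c := @cvg_monotone_convergence _ _ R mu B mB g mg g0 ndg; exact: (cvgP _ c).
apply: nearW => N.
have -> : (\int[mu]_(y in B) g N y)%E = (\int[mu]_(y in B) logsum N (p y))%:E.
  by rewrite fineK//; exact: (integrable_fin_num mB (integrable_logsum N)).
rewrite integral_logsum lee_fin ler_wpM2l// gerBl.
by apply: Rintegral_ge0 => y _; rewrite exprn_ge0// depth0_ge0.
Qed.

(** The mean value property for each power of [p] extends to the partial sums of the logarithm.
    Dominated convergence passes to the limit, [u] being bounded on the ball and [L] integrable,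
    while [moment x r N] tends to 0. *)
Lemma integral_harmonic_log (D : set 'rV[R]_n) (u : 'rV[R]_n -> R) :
  open D -> C2_on D u -> harmonic_on D u -> eclosed_ball x r `<=` D ->
  mu.-integrable B (EFin \o (fun y => u y * L y)) /\
  (\int[mu]_(y in B) (u y * L y)%:E = (2 / n%:R * (u x * moment x r 0))%:E)%E.
Proof.
move=> oD C2u hu BD; have mB := measurable_eball x r.
have cu y : D y -> {for y, continuous u}.
  by move=> Dy; apply/differentiable_continuous; case: C2u => + _; apply.
have [Cu Cu0 uC] := bounded_dil r0 BD cu.
have uCy y : B y -> `|u y| <= Cu.
  by move=> yB; rewrite -(dil1 x y) uC// normr1.
have mu' : measurable_fun B u.
  apply: measurable_fun_continuous_on => // y yB; apply: cu; apply: BD.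
  exact: eball_sub_closed.
pose h N y := u y * logsum N (p y).
have ih N : mu.-integrable B (EFin \o h N).
  have ub : [bounded u y | y in B].
    exists Cu; split; first exact: num_real.
    by move=> M CM y /uCy /le_trans; apply; exact: ltW.
  have := integrableMl mB (integrable_logsum N) mu' ub.
  by apply: eq_integrable => // y _; rewrite /= -EFinM mulrC.
have hE N : \int[mu]_(y in B) h N y = 2 / n%:R * (u x * (moment x r 0 - moment x r N)).
  have E k : \int[mu]_(y in B) (p y ^+ k.+1 * u y) = u x * moment x r k.+1.
    (* The power [t^(k+1)] is the derivative of the kernel [t^(k+2) / (k+2)]; both vanish at 0 and
       are bounded by 1 on [[0, 1]]. *)
    apply: (@integral_kernel_harmonic R n D u oD C2u hu x r r0 BD
      (fun t => k.+2%:R^-1 * t ^+ k.+2) (fun t => t ^+ k.+1) 1).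
    - move=> t _; apply: is_derive_eq (is_deriveZ k.+2%:R^-1 (is_derive_expn k.+1 t)) _.
      by rewrite [_ *: _]mulKf// pnatr_eq0.
    - by rewrite expr0n mulr0.
    - by rewrite expr0n.
    - exact: measurable_funX.
    - move=> t /andP[t0 t1]; rewrite normrM normrX !ger0_norm// mulr_ile1 ?exprn_ge0//.
        by rewrite invf_le1// ler1n.
      exact: exprn_ile1.
    - by move=> t /andP[t0 t1]; rewrite normrX ger0_norm// exprn_ile1.
  rewrite mulrCA -integral_logsum.
  have -> : \int[mu]_(y in B) h N y =
      \int[mu]_(y in B) (\sum_(k < N) k.+1%:R^-1 * (p y ^+ k.+1 * u y)).
    apply: eq_Rintegral => y _; rewrite /h /logsum mulr_sumr.
    by apply: eq_bigr => k _; ring.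
  have ipu k : mu.-integrable B (EFin \o (fun y => p y ^+ k * u y)).
    apply: (integrable_eball r0 (C := Cu)).
      by apply: measurable_funM => //; exact: measurable_depth0X.
    move=> y yB; rewrite normrM -[leRHS]mul1r ler_pM ?uCy//.
    by rewrite normrX exprn_ile1// ger0_norm ?depth0_ge0// depth0_le1.
  rewrite Rintegral_sum// => [|k]; last first.
    by have := integrableZl mB k.+1%:R^-1 (ipu k.+1); apply: eq_integrable.
  rewrite Rintegral_sum// => [|k]; last first.
    have := integrableZl mB k.+1%:R^-1 (integrable_depth0X x r0 k.+1).
    by apply: eq_integrable => // y _; rewrite /= -EFinM mulrC.
  rewrite mulr_sumr; apply: eq_bigr => k _; rewrite RintegralZl// E.
  rewrite RintegralZr//; last exact: integrable_depth0X.
  by rewrite -/(moment x r k.+1) mulrCA [k.+1%:R^-1 * _]mulrC.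
have ch : {ae mu, forall y, B y ->
    (EFin \o h N) y @[N --> \oo] --> (EFin \o (fun y => u y * L y)) y}.
  apply: filterS ae_neq => y yx _; apply: cvg_EFin; first exact: nearW.
  apply: cvgM; first exact: cvg_cst.
  by apply: logsum_cvg; exact: depth0_01.
have bh : {ae mu, forall y N, B y ->
    (`|(EFin \o h N) y| <= (fun y => Cu%:E * (EFin \o L) y) y)%E}.
  apply: filterS ae_neq => y yx N yB; rewrite /= lee_fin normrM ler_pM// ?uCy//.
  rewrite ger0_norm ?logsum_ge0 ?depth0_ge0// logsum_le//; exact: depth0_01.
have iL := integrableZl mB Cu integrable_log_kernel.
have mEuL : measurable_fun B (EFin \o (fun y => u y * L y)).
  apply/measurable_EFinP; apply: measurable_funM => //; exact: measurable_log_kernel.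
have [iuL _ dct] := @dominated_convergence _ _ R mu B mB (fun N => EFin \o h N)
  _ _ (fun N => measurable_int _ (ih N)) mEuL ch iL bh.
split=> //; apply: (cvg_unique _ dct) => //.
rewrite (_ : [sequence _]_N = (fun N =>
    (2 / n%:R * (u x * (moment x r 0 - moment x r N)))%:E)); last first.
  apply/funext => N; rewrite -hE [RHS]fineK//.
  exact: (integrable_fin_num mB (ih N)).
apply: cvg_EFin; first exact: nearW.
apply: cvgM; first exact: cvg_cst; apply: cvgM; first exact: cvg_cst.
rewrite -[X in _ --> X]subr0; apply: cvgB; [exact: cvg_cst|exact: moment_cvg0].
Qed.

End log_kernel.

(** * The logarithmic mean value formula in terms of iterated integrals *)

Theorem theorem3 (R : realType) (m : nat) (D : set 'rV[R]_m) (u : 'rV[R]_m -> R) :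
  (2 <= m)%N -> domain D -> C2_on D u -> harmonic_on D u ->
  forall (x : 'rV[R]_m) (r : R), D x -> 0 < r -> eclosed_ball x r `<=` D ->
  (u x)%:E =
    ((m%:R / fine (ball_vol m r))%:E *
     iint (fun y : 'rV[R]_m =>
             if `[< eball x r y >] then (u y * ln (r / enorm (x - y)))%:E else 0%E))%E.
Proof.
case: m => [//|n] in D u *.
move=> _ [_ [oD _]] C2u hu x r _ r0 BD.
have mB := measurable_eball x r.
have [iuL uLE] := integral_harmonic_log r0 oD C2u hu BD.
(* [ball_vol] is defined with the ball centred at 0; translation invariance identifies it with the
   measure of the ball at [x], which is the moment of order 0. *)
have volE : ball_vol n.+1 r = (moment x r 0)%:E.
  rewrite moment0// lebn_eball_shift /ball_vol.
  rewrite (_ : (fun y => _) = EFin \o \1_(eball (0 : 'rV[R]_n.+1) r)).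
    have mB0 := measurable_eball (0 : 'rV[R]_n.+1) r.
    rewrite iint_integral ?integral_indic ?setIT//.
    apply/integrableP; split; first by apply/measurable_EFinP; exact: measurable_indic.
    under eq_integral do rewrite gee0_abs ?lee_fin//.
    by rewrite integral_indic// setIT; exact: lebn_eball_lty.
  apply/funext => y; rewrite /= indicE; case: asboolP => yB.
    by rewrite mem_set.
  by rewrite memNset.
have vol0 : 0 < moment x r 0.
  by rewrite -lte_fin moment0//; exact: lebn_eball_gt0.
pose g y := u y * (- ln (1 - depth0 x r y)).
(* The factor one half is the one relating [ln (r / |x - y|)] to [- ln (1 - p)]; it cancels the 2 in
   the value [2 / m * u x * |B_r|] of the integral of [g]. *)
have gE : (fun y : 'rV[R]_n.+1 =>
    if `[< eball x r y >] then (u y * ln (r / enorm (x - y)))%:E else 0%E) =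
    (fun y => 2^-1%:E * (EFin \o g) y)%E \_ (eball x r).
  apply/funext => y; rewrite /patch; case: asboolP => yB.
    by rewrite mem_set//= ln_enorm// -EFinM; congr (_%:E); rewrite /g; field.
  by rewrite memNset.
have ig : (lebn R n.+1).-integrable (eball x r) (fun y => 2^-1%:E * (EFin \o g) y)%E.
  exact: integrableZl.
rewrite gE iint_integral; last by apply/(integrable_mkcond _ mB).1.
rewrite -integral_mkcond integralZl// uLE volE /= -!EFinM; congr (_%:E).
field.
by rewrite !gt_eqF.
Qed.
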